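(* For $t\ge2$, $g\in[t-1]$ let $T^{(t)}_g=\mathbb 1\{\max_{s\in\mathcal S^{(t)}}A^{(t)}_{s,g}/\xi^{(t)}_s>1\}$ with $\xi^{(t)}_s=\lambda z(s,p,t)$ for a tuning parameter $\lambda>0$, and $\hat\tau=\inf\{t\ge2:\max_{g\in G^{(t)}}T^{(t)}_g=1\}$. For every $\delta\in(0,1)$ there exist a constant $C_1>0$ depending only on $\delta$ and a constant $C_2>0$ depending only on $\lambda$ and $\delta$ such that: if $\lambda\ge C_1$ then $\mathbb P_\infty(\hat\tau<\infty)\le\delta$; and if $\tau<\infty$ and $\tau\phi^2/\sigma^2\ge C_2 z(k,p,2\tau)$, then $$\mathbb P_\tau\Big\{\hat\tau-\tau\le\Big\lceil C_2\frac{\sigma^2}{\phi^2}z(k,p,2\tau)\Big\rceil\Big\}\ge1-\delta.$$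
   Context: $\log$ is natural, $[n]=\{1,\dots,n\}$, $\inf\emptyset=\infty$. Model: $(Y_i)_{i\in\mathbb N}$ independent in $\mathbb R^p$; under $\mathbb P_\tau$ ($\tau\in\mathbb N\cup\{\infty\}$), $Y_i\sim N_p(\mu_1,\sigma^2I)$ for $i\le\tau$ and $Y_i\sim N_p(\mu_2,\sigma^2I)$ for $i>\tau$, with $\mu_1,\mu_2$ unknown and $\sigma>0$ known. $k=\|\mu_2-\mu_1\|_0$ (number of nonzero entries), $\phi=\|\mu_2-\mu_1\|_2$. CUSUM vector: $C^{(t)}_g=\{g/(t(t-g))\}^{1/2}\sum_{i=1}^{t-g}Y_i-\{(t-g)/(tg)\}^{1/2}\sum_{i=t-g+1}^tY_i$, with entries $C^{(t)}_g(j)$. Threshold: $a^2(s,t)=4\log(ep s^{-2}\log t)\,\mathbb 1\{s\le\sqrt{p\log t}\}$, $a(s,t)\ge0$. For $a\ge0$, $\nu_a=\mathbb E\{Z^2\mid |Z|>a\}$ with $Z\sim N(0,1)$. Statistic: $A^{(t)}_{s,g}=\sum_{j=1}^p\{C^{(t)}_g(j)^2/\sigma^2-\nu_{a(s,t)}\}\mathbb 1\{|C^{(t)}_g(j)|/\sigma>a(s,t)\}$. Sparsity grid: $\mathcal S^{(t)}=\{1,2,4,\dots,2^{\lfloor\log_2(\sqrt{p\log t}\wedge p)\rfloor}\}\cup\{p\}$. Function: $z(s,p,t)=\sqrt{p\log t}$ if $s>\sqrt{p\log t}$, and $z(s,p,t)=s\log\{ep\log t/s^2\}\vee\log t$ otherwise.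 Dynamic geometric grid: for $t\ge2$, $G^{(t)}=\{1\}\cup\bigcup_{j=1}^{\lfloor \log_2\{(t-1)/3\}\rfloor+1}\{g^{(t)}_{L,j}\}\cup\bigcup_{j=1}^{\lfloor\log_2(t-1)\rfloor-1}\{g^{(t)}_{R,j}\}$, $g^{(t)}_{L,j}=2^j+\{(t-1)\bmod 2^{j-1}\}$, $g^{(t)}_{R,j}=g^{(t)}_{L,j}+2^{j-1}$ (empty unions if upper index $<1$). *)

(* Defs.v *)
From HB Require Import structures.
From mathcomp Require Import all_boot all_order all_algebra.
From mathcomp Require Import all_classical all_reals all_analysis.
Set Implicit Arguments. Unset Strict Implicit. Unset Printing Implicit Defensive.
Import Order.TTheory GRing.Theory Num.Theory.
Local Open Scope classical_set_scope.
Local Open Scope ring_scope.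

Section Defs.
Variable R : realType.

Definition log2 (x : R) : R := ln x / ln 2.

(* nu_a = E[Z^2 | |Z| > a], Z ~ N(0,1) *)
Definition tail_set (a : R) : set R := [set x : R | a < `|x|].
Definition nu (a : R) : R :=
  fine (\int[normal_prob (0:R) 1]_(x in tail_set a) ((x ^+ 2)%R)%:E)%E
  / fine (normal_prob (0:R) 1 (tail_set a)).

Definition thr (p s t : nat) : R :=
  if ((s%:R : R) <= Num.sqrt (p%:R * ln t%:R)) then
    Num.sqrt (4 * ln (expR 1 * p%:R / (s%:R ^+ 2) * ln t%:R))
  else 0.

Definition zfun (s p t : nat) : R :=
  if Num.sqrt (p%:R * ln t%:R) < (s%:R : R) then Num.sqrt (p%:R * ln t%:R)
  else Num.max (s%:R * ln (expR 1 * p%:R * ln t%:R / (s%:R ^+ 2))) (ln t%:R).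

Definition in_sgrid (p t s : nat) : Prop :=
  s = p \/ exists j : nat,
    (j%:Z <= Num.floor (log2 (Num.min (Num.sqrt (p%:R * ln t%:R)) p%:R)))%R
    /\ s = (2 ^ j)%N.

Definition gL (t j : nat) : nat := (2 ^ j + (t - 1) %% 2 ^ (j - 1))%N.
Definition gR (t j : nat) : nat := (gL t j + 2 ^ (j - 1))%N.
Definition in_ggrid (t g : nat) : Prop :=
  g = 1%N
  \/ (exists j : nat, (1 <= j)%N /\
        (j%:Z <= Num.floor (log2 ((t%:R - 1) / 3)) + 1)%R /\ g = gL t j)
  \/ (exists j : nat, (1 <= j)%N /\
        (j%:Z <= Num.floor (log2 (t%:R - 1)) - 1)%R /\ g = gR t j).

Variables (d : measure_display) (T : measurableType d).

Definition cusum (p : nat) (Y : nat -> 'I_p -> T -> R) (t g : nat)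
  (j : 'I_p) (w : T) : R :=
  Num.sqrt (g%:R / (t%:R * (t - g)%:R)) * (\sum_(1 <= i < (t - g).+1) Y i j w)
  - Num.sqrt ((t - g)%:R / (t%:R * g%:R)) * (\sum_((t - g).+1 <= i < t.+1) Y i j w).

Definition Astat (p : nat) (Y : nat -> 'I_p -> T -> R) (sigma : R)
  (t s g : nat) (w : T) : R :=
  \sum_(j < p)
    if thr p s t < `|cusum Y t g j w| / sigma then
      (cusum Y t g j w) ^+ 2 / sigma ^+ 2 - nu (thr p s t)
    else 0.

Definition Ttest (p : nat) (Y : nat -> 'I_p -> T -> R) (sigma lam : R)
  (t g : nat) (w : T) : Prop :=
  exists s : nat, in_sgrid p t s /\
    1 < Astat Y sigma t s g w / (lam * zfun s p t).

(* stopping time tau_hat = inf {t >= 2 : max_{g in G^(t)} T^(t)_g = 1}, inf of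
   the empty set = +oo *)
Definition tau_hat (p : nat) (Y : nat -> 'I_p -> T -> R) (sigma lam : R)
  (w : T) : \bar R :=
  ereal_inf [set (t%:R)%:E | t in
    [set t : nat | (2 <= t)%N /\ exists g, in_ggrid t g /\ Ttest Y sigma lam t g w]].

Definition mutually_independent (I : eqType) (P : probability T R)
  (X : I -> T -> R) : Prop :=
  (forall i, measurable_fun setT (X i)) /\
  forall (J : seq I) (B : I -> set R), uniq J -> (forall i, measurable (B i)) ->
    fine (P (\bigcap_(i in [set` J]) (X i @^-1` B i))) =
    \prod_(i <- J) fine (P (X i @^-1` B i)).

(* mean of Y_i(j) under P_tau; tau = None encodes tau = infinity *)
Definition mean_at (p : nat) (mu1 mu2 : 'I_p -> R) (tau : option nat)
  (i : nat) (j : 'I_p) : R :=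
  match tau with
  | None => mu1 j
  | Some tau => if (i <= tau)%N then mu1 j else mu2 j
  end.

(* the model P_tau: (Y_i)_{i >= 1} independent, Y_i ~ N_p(mean, sigma^2 I),
   i.e. all coordinates Y_i(j) (i >= 1, j in [p]) independent with
   Y_i(j) ~ N(mean_i(j), sigma^2) *)
Definition gauss_model (P : probability T R) (p : nat)
  (Y : nat -> 'I_p -> T -> R) (sigma : R) (mu1 mu2 : 'I_p -> R)
  (tau : option nat) : Prop :=
  mutually_independent P (fun ij : nat * 'I_p => Y ij.1.+1 ij.2) /\
  forall (i : nat) (j : 'I_p) (B : set R), (1 <= i)%N -> measurable B ->
    P (Y i j @^-1` B) = normal_prob (mean_at mu1 mu2 tau i j) sigma B.

End Defs.

Arguments zfun {R}.
Arguments thr {R}.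
Arguments in_sgrid {R}.
Arguments in_ggrid {R}.

Definition sparsity (R : realType) (p : nat) (mu1 mu2 : 'I_p -> R) : nat :=
  #|[set j : 'I_p | mu2 j != mu1 j]|.
Definition l2dist (R : realType) (p : nat) (mu1 mu2 : 'I_p -> R) : R :=
  Num.sqrt (\sum_(j < p) (mu2 j - mu1 j) ^+ 2).

(* Main.v *)
(* For each pair (t, g) the standardised CUSUM coordinates are independent unit
   normals, centred except, after the change, on the support of mu2 - mu1.  With q = P(|Z| > a),
   the truncated and centred square (Z^2 - nu_a) 1{|Z| > a} has moment generating
   function at most exp(1152 th^2 q) for |th| <= 1/8; this rests on
   E[exp((Z^2 - a^2)/4) 1{|Z| > a}] <= 2 q, obtained from the affine substitution
   z = 2 u - a that fixes the endpoint of the half line.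

   False alarms: a Chernoff bound with th = min(1, log t / s)/8 gives a tail
   exp(- lambda/32 (log t + log(e p log t / s^2)/2)), which is geometric in s
   along the sparsity grid, so a union bound over all t, all g < t and all s is
   at most delta once lambda is large.

   Detection: at t = tau + D, where D is the announced delay, the grid contains
   some g with D/3 <= g <= D, and the mean of the CUSUM vector then has squared
   norm at least D phi^2 / (12 sigma^2).  Since (W^2 - nu_a) 1{|W| > a} >= W^2 - nu_a,
   the coordinates in the support are treated without truncation, and a Chernoff bound
   at th = 1/(16 z(k,p,2 tau)) for the lower tail of the statistic concludes; s is
   p if k > sqrt(p log t), and the power of 2 just below k otherwise. *)

Require Import Defs.
From HB Require Import structures.
From mathcomp Require Import all_boot all_order all_algebra.
From mathcomp Require Import all_classical all_reals all_analysis.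
From mathcomp Require Import measurable_realfun.
From mathcomp Require Import zify ring lra.
Import Order.TTheory GRing.Theory Num.Theory.
Local Open Scope classical_set_scope.
Local Open Scope ring_scope.

Set Implicit Arguments. Unset Strict Implicit. Unset Printing Implicit Defensive.

(** * Affine substitution and normal laws *)

(** The factor q in the moment bound carries the sparse case. The threshold makes exp(-a^2/4) so
    small that p q <= s^2 / log t, and the variance term th^2 p q then stays below a multiple of th
    z once th s is at most of order log t; this is why th shrinks like log t / s for large s.
    Expectations are integrals of nonnegative functions in the extended reals, so Tonelli and
    monotonicity apply without integrability proofs; the signed term th (Z^2 - nu_a) is handled by
    moving its negative half across the inequality. The model gives independence of scalars, whereas
    the Chernoff bounds need independence of p linear combinations of them. The passage goes through
    the sigma-algebras generated by disjoint blocks of coordinates. For detection, the statistic is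
    tuned with log t and the guarantee with log (2 tau). The signal condition gives D <= tau, hence
    t <= 2 tau; k may be sparse at one of these times and dense at the other, which costs only
    constants. *)

Definition pushforward_measure d1 d2 (T1 : measurableType d1)
    (T2 : measurableType d2) (R : realFieldType)
    (m : {measure set T1 -> \bar R}) (f : T1 -> T2)
    (mf : measurable_fun setT f) : {measure set T2 -> \bar R} :=
  measure_function_pushforward__canonical__measure_function_Measure m mf.

Lemma affine_measurable (R : realType) (c b : R) :
  measurable_fun [set: R] (fun x : R => c * x + b).
Proof. by apply: measurable_funD => //; exact: measurable_funM. Qed.

(** The right side is the scaled image of Lebesgue measure under the affine map. It has the right
    value on intervals open on the left and closed on the right, which determines it. A negative [c]
    reverses the interval, hence the cases by sign. *)
Lemma lebesgue_measure_affine (R : realType) (c b : R) (A : set R) :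
  c != 0 -> measurable A ->
  lebesgue_measure A = (`|c|%:E * lebesgue_measure ((fun x => (c * x + b)%R) @^-1` A))%E.
Proof.
move=> c0 mA.
pose f := fun x : R => c * x + b.
have mf : @measurable_fun _ _ (measurableTypeR R) (measurableTypeR R) setT f.
  exact: affine_measurable.
pose m : {measure set (measurableTypeR R) -> \bar R} :=
  mscale (NngNum (normr_ge0 c)) (pushforward_measure (@lebesgue_measure R) mf).
change (lebesgue_measure A = m A).
apply: lebesgue_measure_unique => // _ [[x y] _ <-] /=.
rewrite /m /mscale/= /pushforward lebesgue_measure_itv/= lte_fin.
have [cp|cn|] := ltgtP 0 c; last by move=> ce; rewrite -ce eqxx in c0.
- have -> : f @^-1` `]x, y]%classic = `](x - b) / c, (y - b) / c]%classic.
    apply/seteqP; split => z /=; rewrite !in_itv/= /f ltr_pdivrMr// ler_pdivlMr//;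
      by rewrite ltrBlDr lerBrDr mulrC.
  rewrite lebesgue_measure_itv/= lte_fin ltr_pM2r ?invr_gt0// ltrD2r.
  case: ifP => _; last by rewrite mule0.
  by rewrite -!EFinD -EFinM gtr0_norm//; congr EFin; field; rewrite gt_eqF.
- have -> : f @^-1` `]x, y]%classic = `[(y - b) / c, (x - b) / c[%classic.
    apply/seteqP; split => z /=; rewrite !in_itv/= /f ltr_ndivlMr// ler_ndivrMr//;
      by rewrite ltrBlDr lerBrDr mulrC andbC.
  rewrite lebesgue_measure_itv/= lte_fin ltr_nM2r ?invr_lt0// ltrD2r.
  case: ifP => _; last by rewrite mule0.
  by rewrite -!EFinD -EFinM ltr0_norm//; congr EFin; field; rewrite lt_eqF.
Qed.

Lemma ge0_integral_affine (R : realType) (c b : R) (f : R -> \bar R) :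
  c != 0 -> measurable_fun setT f -> (forall x, 0 <= f x)%E ->
  (\int[lebesgue_measure]_x f x = `|c|%:E * \int[lebesgue_measure]_x f (c * x + b)%R)%E.
Proof.
move=> c0 mf f0.
pose g := fun x : R => c * x + b.
have mg : @measurable_fun _ _ (measurableTypeR R) (measurableTypeR R) setT g.
  exact: affine_measurable.
pose m : {measure set (measurableTypeR R) -> \bar R} :=
  mscale (NngNum (normr_ge0 c)) (pushforward_measure (@lebesgue_measure R) mg).
transitivity (\int[m]_x f x)%E.
  apply: eq_measure_integral => A mA _; exact: lebesgue_measure_affine.
rewrite ge0_integral_mscale//=; congr (_ * _)%E.
by rewrite ge0_integral_pushforward// => y _; exact: f0.
Qed.

(** The change of variables speaks of the Radon-Nikodym derivative. It equals [normal_pdf] almost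
    everywhere, since both integrate to [normal_prob] over every measurable set. *)
Lemma ge0_integral_normal_prob (R : realType) (m s : R) (f : R -> \bar R) (E : set R) :
  measurable E -> measurable_fun E f -> (forall x, 0 <= f x)%E ->
  (\int[normal_prob m s]_(x in E) f x =
   \int[lebesgue_measure]_(x in E) (f x * (normal_pdf m s x)%:E))%E.
Proof.
move=> mE mf f0.
rewrite -(@Radon_Nikodym_SigmaFinite.change_of_variables _ _ _ (normal_prob m s)
  (@lebesgue_measure R))//; last exact: normal_prob_dominates.
have dom := @normal_prob_dominates R m s.
have mpdf : measurable_fun setT (fun x => (normal_pdf m s x)%:E).
  by apply/measurable_EFinP; exact: measurable_normal_pdf.
have mRN := measurable_int _ (Radon_Nikodym_SigmaFinite.f_integrable dom).
apply: ae_eq_integral => //.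
- by apply: emeasurable_funM => //; apply: measurable_funTS.
- by apply: emeasurable_funM => //; apply: measurable_funTS.
- apply: ae_eqe_mul2l; apply: integral_ae_eq => //.
  + apply: integrableS (Radon_Nikodym_SigmaFinite.f_integrable dom) => //.
  + exact: measurable_funTS.
  + by move=> A _ mA; rewrite -Radon_Nikodym_SigmaFinite.f_integral.
Qed.

Definition indep2 (R : realType) d (T : measurableType d) (P : probability T R)
    (U V : T -> R) :=
  forall A B, measurable A -> measurable B ->
    P (U @^-1` A `&` V @^-1` B) = (P (U @^-1` A) * P (V @^-1` B))%E.

Definition has_law (R : realType) d (T : measurableType d) (P : probability T R)
    (U : T -> R) (m : set R -> \bar R) :=
  forall A, measurable A -> P (U @^-1` A) = m A.

Lemma ge0_integral_realZ d (T : measurableType d) (R : realType)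
    (mu : {measure set T -> \bar R}) (c : R) (f : T -> R) :
  measurable_fun setT f -> (forall x, 0 <= f x) -> 0 <= c ->
  (\int[mu]_x (c * f x)%:E = c%:E * \int[mu]_x (f x)%:E)%E.
Proof.
move=> mf f0 c0; under eq_integral do rewrite EFinM.
rewrite ge0_integralZl//; first exact/measurable_EFinP.
by move=> x _; rewrite lee_fin.
Qed.

Section two_variables.
Context (R : realType) d (T : measurableType d) (P : probability T R).
Implicit Types U V : T -> R.

Lemma has_law_integral d' (T' : measurableType d') (U : T -> T')
    (m : {measure set T' -> \bar R}) (f : T' -> \bar R) :
  measurable_fun setT U -> (forall A, measurable A -> P (U @^-1` A) = m A) ->
  measurable_fun setT f -> (forall x, 0 <= f x)%E ->
  (\int[P]_w f (U w) = \int[m]_x f x)%E.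
Proof.
move=> mU lU mf f0; rewrite -(@ge0_integral_pushforward _ _ _ _ _ _ mU P setT f)//.
by apply: eq_measure_integral => A mA _; exact: lU.
Qed.

(** By independence the joint law agrees with the product measure on rectangles, hence everywhere;
    Tonelli then iterates the integral. *)
Lemma indep2_integral d1 d2 (T1 : measurableType d1) (T2 : measurableType d2)
    (U : T -> T1) (V : T -> T2) (mU : probability T1 R) (mV : probability T2 R)
    (F : T1 * T2 -> \bar R) :
  measurable_fun setT U -> measurable_fun setT V ->
  (forall A, measurable A -> P (U @^-1` A) = mU A) ->
  (forall A, measurable A -> P (V @^-1` A) = mV A) ->
  (forall A B, measurable A -> measurable B ->
    P (U @^-1` A `&` V @^-1` B) = P (U @^-1` A) * P (V @^-1` B))%E ->
  measurable_fun setT F -> (forall z, 0 <= F z)%E ->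
  (\int[P]_w F (U w, V w) = \int[mU]_x \int[mV]_y F (x, y))%E.
Proof.
move=> meU meV lU lV iUV mF F0.
rewrite -(fubini_tonelli1 (m1 := mU) (m2 := mV))//.
pose UV : T -> T1 * T2 := fun w => (U w, V w).
have mUV : measurable_fun setT UV by apply/measurable_fun_pairP; split.
transitivity (\int[pushforward_measure P mUV]_z F z)%E.
  by rewrite ge0_integral_pushforward.
apply: eq_measure_integral => A mA _; apply/esym.
apply: product_measure_unique => // A1 A2 mA1 mA2.
change (P (UV @^-1` (A1 `*` A2)) = mU A1 * mV A2)%E.
by rewrite -(lU _ mA1) -(lV _ mA2) -iUV.
Qed.

Lemma indep2_integralM U V (f g : R -> R) :
  measurable_fun setT U -> measurable_fun setT V -> indep2 P U V ->
  measurable_fun setT f -> measurable_fun setT g ->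
  (forall x, 0 <= f x) -> (forall x, 0 <= g x) ->
  (\int[P]_w (f (U w) * g (V w))%:E =
   \int[P]_w (f (U w))%:E * \int[P]_w (g (V w))%:E)%E.
Proof.
move=> mU mV iUV mf mg f0 g0.
have pr W (mW : measurable_fun setT W) :
    exists mW' : probability R R, has_law P W mW'.
  pose W' := HB.pack_for {mfun T >-> R} W (isMeasurableFun.Build _ _ _ _ _ mW).
  by exists (distribution P W').
have [lU lUE] := pr _ mU; have [lV lVE] := pr _ mV.
pose F := fun z : R * R => (f z.1 * g z.2)%:E.
have mF : measurable_fun setT F.
  apply/measurable_EFinP; apply: measurable_funM.
    by apply: (@measurableT_comp _ _ _ _ _ _ f).
  by apply: (@measurableT_comp _ _ _ _ _ _ g).
have mf' : measurable_fun setT (EFin \o f) by exact/measurable_EFinP.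
have mg' : measurable_fun setT (EFin \o g) by exact/measurable_EFinP.
have f0' x : (0 <= (EFin \o f) x)%E by rewrite lee_fin.
have g0' x : (0 <= (EFin \o g) x)%E by rewrite lee_fin.
have F0 z : (0 <= F z)%E by rewrite lee_fin mulr_ge0.
rewrite (@indep2_integral _ _ _ _ U V lU lV F)//.
rewrite (has_law_integral mU lUE mf' f0') (has_law_integral mV lVE mg' g0').
rewrite -ge0_integralZr//; last by apply: integral_ge0 => x _; exact: g0'.
apply: eq_integral => x _ /=; rewrite -ge0_integralZl// ?lee_fin//; move=> y _; exact: (g0' y).
Qed.

End two_variables.

(** * Multiples and sums of independent normal variables *)

Section normal_laws.
Context (R : realType).
Implicit Types m s c x y : R.

Lemma square_completion a b x y m1 m2 : 0 < a -> 0 < b ->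
  - (x - m1) ^+ 2 / (a *+ 2) + - (y - x - m2) ^+ 2 / (b *+ 2) =
  - (y - m1 - m2) ^+ 2 / ((a + b) *+ 2) +
  - (x - m1 - (y - m1 - m2) * a / (a + b)) ^+ 2 / (a * b / (a + b) *+ 2).
Proof.
move=> a0 b0; have ab0 : 0 < a + b by rewrite addr_gt0.
have -> : y - x - m2 = (y - m1 - m2) - (x - m1) by ring.
move: (x - m1) (y - m1 - m2) => u v.
by field; rewrite !gt_eqF.
Qed.

(** The first factor on the right is the density of the sum at [y]; the second is the conditional
    density of the first summand given that sum, so it integrates to 1 in [x]. *)
Lemma normal_pdf_conv m1 m2 s1 s2 x y : s1 != 0 -> s2 != 0 ->
  let s := Num.sqrt (s1 ^+ 2 + s2 ^+ 2) in
  normal_pdf m1 s1 x * normal_pdf m2 s2 (y - x) =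
  normal_pdf (m1 + m2) s y *
  normal_pdf ((m1 * s2 ^+ 2 + (y - m2) * s1 ^+ 2) / s ^+ 2) (s1 * s2 / s) x.
Proof.
move=> s10 s20 s.
have s1p : 0 < s1 ^+ 2 by rewrite exprn_even_gt0.
have s2p : 0 < s2 ^+ 2 by rewrite exprn_even_gt0.
have sp : 0 < s1 ^+ 2 + s2 ^+ 2 by rewrite addr_gt0.
have s0 : s != 0 by rewrite gt_eqF// sqrtr_gt0.
have sE : s ^+ 2 = s1 ^+ 2 + s2 ^+ 2 by rewrite sqr_sqrtr// ltW.
clearbody s; have s'0 : s1 * s2 / s != 0 by rewrite !mulf_neq0// invr_eq0.
rewrite !normal_pdfE// /normal_peak /normal_fun.
rewrite mulrACA [RHS]mulrACA -!expRD -!invfM.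
have p2 z : 0 <= z ^+ 2 * pi *+ 2 :> R.
  by rewrite mulrn_wge0// mulr_ge0 ?pi_ge0// sqr_ge0.
rewrite -!sqrtrM//; congr (_^-1 * expR _).
- congr Num.sqrt; rewrite expr_div_n.
  by move: (pi : R) => q; field.
- rewrite expr_div_n exprMn sE square_completion//; congr (_ + _).
    by rewrite -addrA -opprD.
  congr (- _ ^+ 2 / _).
  by field; rewrite gt_eqF.
Qed.

Lemma normal_pdf_scale m s c x : s != 0 -> c != 0 ->
  `|c| * normal_pdf (c * m) (`|c| * s) (c * x) = normal_pdf m s x.
Proof.
move=> s0 c0.
have cs0 : `|c| * s != 0 by rewrite mulf_neq0// normr_eq0.
rewrite !normal_pdfE// /normal_peak /normal_fun exprMn real_normK ?num_real//.
have -> : c ^+ 2 * s ^+ 2 * pi *+ 2 = c ^+ 2 * (s ^+ 2 * pi *+ 2).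
  by rewrite -mulrA mulrnAr.
rewrite sqrtrM ?sqr_ge0// sqrtr_sqr invfM !mulrA divff ?normr_eq0// mul1r.
congr (_ * expR _); field.
by rewrite s0 c0.
Qed.

Lemma normal_prob_indic m s (A : set R) : measurable A ->
  (normal_prob m s A = \int[lebesgue_measure]_x (\1_A x * normal_pdf m s x)%:E)%E.
Proof.
move=> mA; rewrite /normal_prob integral_mkcond; apply: eq_integral => x _.
by rewrite patchE indicE; case: ifP => _; rewrite ?mul1r ?mul0r.
Qed.

Lemma measurable_normal_pdf2 m s :
  measurable_fun setT (fun z : R * R => (normal_pdf m s (z.2 - z.1))).
Proof.
apply: (@measurableT_comp _ _ _ _ _ _ (normal_pdf m s)).
  exact: measurable_normal_pdf.
by apply: measurable_funB.
Qed.

Context d (T : measurableType d) (P : probability T R).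
Implicit Types U V : T -> R.

Lemma has_lawZ U m s c : measurable_fun setT U -> s != 0 -> c != 0 ->
  has_law P U (normal_prob m s) ->
  has_law P (fun w => c * U w) (normal_prob (c * m) (`|c| * s)).
Proof.
move=> mU s0 c0 lU A mA.
pose g := fun x : R => c * x.
have mg : measurable_fun setT g by exact: measurable_funM.
have mgA : measurable (g @^-1` A) by rewrite -[X in measurable X]setTI; exact: mg.
transitivity (normal_prob m s (g @^-1` A)); first exact: lU.
rewrite (normal_prob_indic m s mgA) (normal_prob_indic _ _ mA).
rewrite [RHS](@ge0_integral_affine _ c 0)//; last 2 first.
- apply/measurable_EFinP/measurable_funM; first exact: measurable_indic.
  exact: measurable_normal_pdf.
- by move=> x; rewrite lee_fin mulr_ge0// normal_pdf_ge0.
rewrite -ge0_integralZl//; last 2 first.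
- have := affine_measurable c 0 => maf.
  apply/measurable_EFinP/measurable_funM.
    by apply: (measurableT_comp (measurable_indic mA)).
  by apply: (measurableT_comp (measurable_normal_pdf _ _)).
- by move=> x _; rewrite lee_fin mulr_ge0// normal_pdf_ge0.
apply: eq_integral => x _; rewrite addr0 -EFinM mulrCA normal_pdf_scale//.
Qed.

(** Shifting the inner integral by [- x] turns the integrand into the joint density [G] of [U] and
    [U + V]. After exchanging the integrals, [normal_pdf_conv] lets the conditional density of [U]
    integrate to 1. *)
Lemma has_lawD U V m1 m2 s1 s2 :
  measurable_fun setT U -> measurable_fun setT V -> s1 != 0 -> s2 != 0 ->
  has_law P U (normal_prob m1 s1) -> has_law P V (normal_prob m2 s2) ->
  indep2 P U V ->
  has_law P (fun w => U w + V w)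
    (normal_prob (m1 + m2) (Num.sqrt (s1 ^+ 2 + s2 ^+ 2))).
Proof.
move=> mU mV s10 s20 lU lV iUV A mA.
have mUV : measurable_fun setT (fun w => U w + V w) by exact: measurable_funD.
have mE : measurable ((fun w => U w + V w) @^-1` A).
  by rewrite -[X in measurable X]setTI; exact: mUV.
rewrite -[X in P X]setIT -integral_indic//.
pose F := fun z : measurableTypeR R * measurableTypeR R =>
  (\1_A (z.1 + z.2 : R) : R)%:E.
have mF : measurable_fun setT F.
  apply/measurable_EFinP.
  by apply: (measurableT_comp (measurable_indic mA)); exact: measurable_funD.
have F0 z : (0 <= F z)%E by rewrite lee_fin.
transitivity (\int[P]_w F (U w, V w))%E; first by apply: eq_integral.
rewrite (@indep2_integral _ _ _ P _ _ (measurableTypeR R)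
  (measurableTypeR R) U V (normal_prob m1 s1) (normal_prob m2 s2) F)//.
pose G := fun z : measurableTypeR R * measurableTypeR R =>
  (\1_A (z.2 : R) * normal_pdf m2 s2 (z.2 - z.1) * normal_pdf m1 s1 z.1 : R)%:E.
have mG : measurable_fun setT G.
  apply/measurable_EFinP/measurable_funM; last first.
    by apply: (measurableT_comp (measurable_normal_pdf _ _)).
  apply: measurable_funM; last exact: measurable_normal_pdf2.
  by apply: (measurableT_comp (measurable_indic mA)).
have G0 z : (0 <= G z)%E.
  by rewrite lee_fin !mulr_ge0// normal_pdf_ge0.
transitivity (\int[lebesgue_measure]_x \int[lebesgue_measure]_y G (x, y))%E.
  have mF1 : measurable_fun setT
      (fun x : R => \int[normal_prob m2 s2]_y F (x, y))%E.
    apply: (measurable_fun_fubini_tonelli_F (m2 := normal_prob m2 s2) F).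
    - exact: mF.
    - exact: F0.
  have F10 (x : R) : (0 <= \int[normal_prob m2 s2]_y F (x, y))%E.
    by apply: integral_ge0 => y _; rewrite lee_fin.
  rewrite (ge0_integral_normal_prob m1 s1 measurableT mF1 F10).
  apply: eq_integral => x _.
  have mx : measurable_fun setT (fun y : R => \1_A (x + y) : R).
    by apply: (measurableT_comp (measurable_indic mA)); exact: measurable_funD.
  rewrite ge0_integral_normal_prob//; last first.
    exact/measurable_EFinP.
  rewrite (@ge0_integral_affine _ 1 (- x)) ?oner_neq0//; last 2 first.
  - apply/measurable_EFinP/measurable_funM => //; exact: measurable_normal_pdf.
  - by move=> y; rewrite /F -EFinM lee_fin mulr_ge0// normal_pdf_ge0.
  rewrite normr1 mul1e muleC.
  under eq_integral => y _ do
    rewrite /F -EFinM mul1r [X in \1_A X]addrCA subrr addr0.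
  rewrite -ge0_integral_realZ//.
  - by apply: eq_integral => y _; rewrite /G/= mulrC.
  - apply: measurable_funM; first exact: measurable_indic.
    apply: (measurableT_comp (measurable_normal_pdf _ _)).
    exact: measurable_funB.
  - by move=> y; rewrite mulr_ge0// normal_pdf_ge0.
  - exact: normal_pdf_ge0.
rewrite (fubini_tonelli (m1 := lebesgue_measure) (m2 := lebesgue_measure))//.
rewrite normal_prob_indic//; apply: eq_integral => y _.
rewrite /G/=.
under eq_integral => x _ do
  rewrite -mulrA [_ * normal_pdf m1 _ _]mulrC normal_pdf_conv// mulrA.
rewrite ge0_integral_realZ ?integral_normal_pdf ?mule1//.
- exact: measurable_normal_pdf.
- by move=> x; exact: normal_pdf_ge0.
- by rewrite mulr_ge0// normal_pdf_ge0.
Qed.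

End normal_laws.

(** * Independence of disjoint blocks of a family *)

Section grouping.
Context (R : realType) d (T : measurableType d) (P : probability T R).
Context (I : eqType) (X : I -> T -> R).
Hypothesis indX : mutually_independent P X.

(** Cylinder sets: a family closed under intersection that generates the sigma-algebra of the [X i]
    with [i] in [J]. *)
Definition rects (J : seq I) : set (set T) :=
  [set E | exists2 B : I -> set R, forall i, measurable (B i) &
    E = \bigcap_(i in [set` J]) (X i @^-1` B i)].

Lemma measurable_family i : measurable_fun setT (X i). Proof. by case: indX. Qed.

Lemma measurable_preX i B : measurable B -> measurable (X i @^-1` B).
Proof. by move=> mB; rewrite -[X in measurable X]setTI; exact: measurable_family. Qed.

Lemma rects_measurable J : rects J `<=` measurable.
Proof.
move=> _ [B mB ->]; apply: fin_bigcap_measurable => // i _.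
exact: measurable_preX.
Qed.

Lemma rects_setT J : rects J setT.
Proof.
exists (fun=> setT) => //; apply/esym/seteqP; split => // w _ i _.
Qed.

Lemma rects_setI J : setI_closed (rects J).
Proof.
move=> _ _ [B mB ->] [C mC ->]; exists (fun i => B i `&` C i).
  by move=> i; exact: measurableI.
by rewrite -bigcapI; apply: eq_bigcapr => i _; rewrite preimage_setI.
Qed.

Lemma rects_sub J J' : {subset J <= J'} -> rects J `<=` rects J'.
Proof.
move=> JJ' _ [B mB ->]; exists (fun i => if i \in J then B i else setT).
  by move=> i; case: ifP.
apply/seteqP; split => w wB i /= iJ.
  by case: ifPn => // iJ'; exact: (wB i iJ').
by have := wB i (JJ' _ iJ); rewrite /= iJ.
Qed.

Lemma rects_indep J J' E E' : uniq (J ++ J') -> rects J E -> rects J' E' ->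
  P (E `&` E') = (P E * P E')%E.
Proof.
move=> uJ rE rE'.
have mE := rects_measurable rE; have mE' := rects_measurable rE'.
move: rE rE' mE mE' => [B mB ->] [C mC ->] mE mE'.
pose D i := if i \in J then B i else C i.
have mD i : measurable (D i) by rewrite /D; case: ifP.
move: (uJ); rewrite cat_uniq => /and3P[uJ1 /hasPn JJ' uJ2].
have EE : \bigcap_(i in [set` J]) (X i @^-1` B i) `&`
    \bigcap_(i in [set` J']) (X i @^-1` C i) =
    \bigcap_(i in [set` J ++ J']) (X i @^-1` D i).
  apply/seteqP; split => [w [wB wC] i|w wD].
    rewrite /= mem_cat /D; case: ifPn => /= [iJ _|_ iJ'].
      exact: wB.
    exact: wC.
  split => i /= iJ.
    by have := wD i; rewrite /= mem_cat iJ /D iJ; exact.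
  have := wD i; rewrite /= mem_cat iJ orbT /D (negbTE (JJ' _ iJ)); exact.
have [_ pr] := indX.
have fE A : measurable A -> P A = (fine (P A))%:E.
  by move=> mA; rewrite fineK// fin_num_measure.
rewrite EE [LHS]fE; last by rewrite -EE; exact: measurableI.
rewrite (fE _ mE) (fE _ mE') -EFinM pr// pr// pr// big_cat/=.
congr (_ * _)%:E; apply: eq_big_seq => i iJ; rewrite /D.
  by rewrite iJ.
by rewrite (negbTE (JJ' _ iJ)).
Qed.

Lemma sigma_measurable J : <<s rects J >> `<=` measurable.
Proof.
apply: smallest_sub; last exact: rects_measurable.
exact: sigma_algebra_measurable.
Qed.

(** For fixed [E'], both sides are finite measures in [E]; agreeing on a generating family closed
    under intersection, they agree on the generated sigma-algebra. Using this once in each argument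
    gives [sigma_indep]. *)
Lemma sigma_indep_step (G : set (set T)) E' :
  G `<=` measurable -> setI_closed G -> G setT -> measurable E' ->
  (forall E, G E -> P (E `&` E') = P E * P E')%E ->
  forall E, <<s G >> E -> (P (E `&` E') = P E * P E')%E.
Proof.
move=> Gm GI GT mE' GE E sE.
pose m1 : {measure set T -> \bar R} := mrestr P mE'.
pose m2 : {measure set T -> \bar R} := mscale (NngNum (fine_ge0 (measure_ge0 P E'))) P.
have fE : (fine (P E'))%:E = P E' by rewrite fineK// fin_num_measure.
have m2E A : m2 A = (P A * P E')%E.
  by rewrite /m2/= /mscale/= fE muleC.
suff : m1 E = m2 E by rewrite m2E.
apply: (@g_sigma_algebra_measure_unique _ _ _ G Gm (fun=> setT)) => //.
- by rewrite bigcup_const.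
- by move=> A GA; rewrite m2E -GE.
- move=> _; rewrite /m1/= /mrestr/= setTI.
  by rewrite ltey_eq fin_num_measure.
Qed.

Lemma sigma_indep J J' E E' : uniq (J ++ J') ->
  <<s rects J >> E -> <<s rects J' >> E' -> (P (E `&` E') = P E * P E')%E.
Proof.
move=> uJ sE sE'.
apply: (sigma_indep_step (@rects_measurable J) (@rects_setI J) (rects_setT J)) => //.
  exact: sigma_measurable sE'.
move=> {}E {}sE; rewrite setIC muleC.
apply: (sigma_indep_step (@rects_measurable J') (@rects_setI J') (rects_setT J')) => //.
  exact: rects_measurable sE.
by move=> F rF; rewrite setIC muleC; exact: rects_indep sE rF.
Qed.

(** Phrased as measurability for a generated sigma-algebra, so that sums, products and compositions
    inherit it from the general rules for measurable functions. *)
Definition depends_on (J : seq I) (V : T -> R) :=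
  measurable_fun (setT : set (g_sigma_algebraType (rects J))) V.

Lemma depends_on_preimage J V B : depends_on J V -> measurable B ->
  <<s rects J >> (V @^-1` B).
Proof. by move=> dV mB; rewrite -[V @^-1` B]setTI; exact: dV. Qed.

Lemma depends_on_measurable J V : depends_on J V -> measurable_fun setT V.
Proof.
move=> dV _ B mB; rewrite setTI; apply: (@sigma_measurable J).
exact: depends_on_preimage.
Qed.

Lemma depends_on_sub J J' V : {subset J <= J'} -> depends_on J V ->
  depends_on J' V.
Proof.
move=> JJ' dV _ B mB; rewrite setTI.
have sub : <<s rects J >> `<=` <<s rects J' >>.
  apply: smallest_sub; first exact: smallest_sigma_algebra.
  exact: (subset_trans (rects_sub JJ') (@sub_sigma_algebra _ setT _)).
apply: sub; exact: depends_on_preimage.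
Qed.

Lemma depends_on_X i : depends_on [:: i] (X i).
Proof.
move=> _ B mB; rewrite setTI; apply: sub_sigma_algebra.
exists (fun=> B) => //; apply/seteqP; split => [w wB j|w]; last first.
  by apply; rewrite /= mem_seq1.
by rewrite /= mem_seq1 => /eqP ->.
Qed.

Lemma depends_on_indep J J' U V : uniq (J ++ J') ->
  depends_on J U -> depends_on J' V -> indep2 P U V.
Proof.
move=> uJ dU dV A B mA mB; apply: (sigma_indep uJ); exact: depends_on_preimage.
Qed.

Lemma depends_on_comp J (f : R -> R) V : measurable_fun setT f ->
  depends_on J V -> depends_on J (f \o V).
Proof. by move=> mf dV; exact: (measurableT_comp mf dV). Qed.

Lemma depends_on_lin J (c : I -> R) :
  depends_on J (fun w => \sum_(i <- J) c i * X i w).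
Proof.
elim: J => [|i J IH].
  by under eq_fun do rewrite big_nil; exact: measurable_cst.
under eq_fun do rewrite big_cons.
apply: measurable_funD; last by apply: (depends_on_sub _ IH) => j; rewrite inE orbC => ->.
apply: (@depends_on_comp _ (fun x => c i * x)); first exact: measurable_funM.
by apply: (depends_on_sub _ (@depends_on_X i)) => j; rewrite mem_seq1 inE => ->.
Qed.

(** Induction with [has_lawD]. A nonempty [J] with nonzero coefficients keeps every partial standard
    deviation nonzero, as that lemma demands. *)
Lemma normal_lin (J : seq I) (c m : I -> R) (s : R) :
  uniq J -> J != [::] -> s != 0 ->
  (forall i, i \in J -> c i != 0) ->
  (forall i, i \in J -> has_law P (X i) (normal_prob (m i) s)) ->
  has_law P (fun w => \sum_(i <- J) c i * X i w)
    (normal_prob (\sum_(i <- J) c i * m i)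
       (Num.sqrt (\sum_(i <- J) c i ^+ 2) * `|s|)).
Proof.
elim: J => // i J IH /= /andP[iJ uJ] _ s0 c0 lX.
have c0i : c i != 0 by rewrite c0// inE eqxx.
have lXi : has_law P (fun w => c i * X i w) (normal_prob (c i * m i) (`|c i| * s)).
  by apply: has_lawZ => //; [exact: measurable_family|apply: lX; rewrite inE eqxx].
(* The density depends on the standard deviation only through its square, so [s] may be replaced by
   its absolute value. *)
have nu0 t A : measurable A -> normal_prob (c i * m i) t A =
    normal_prob (c i * m i) `|t| A.
  move=> mA; rewrite /normal_prob; apply: eq_integral => x _.
  rewrite /normal_pdf normr_eq0 /normal_peak /normal_fun.
  by rewrite real_normK// num_real.
have {}lXi : has_law P (fun w => c i * X i w)
    (normal_prob (c i * m i) (`|c i| * `|s|)).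
  by move=> A mA; rewrite (lXi A mA) (nu0 _ A mA) normrM normr_id.
have [J0|Jn0] := eqVneq J [::].
  rewrite J0; under eq_fun do rewrite big_seq1.
  by rewrite !big_seq1 sqrtr_sqr.
have cJ j : j \in J -> c j != 0 by move=> jJ; rewrite c0// inE jJ orbT.
have {}IH := IH uJ Jn0 s0 cJ _.
have sumc0 : 0 < \sum_(j <- J) c j ^+ 2.
  case: J Jn0 cJ {iJ uJ c0 lX IH} => // j J _ cJ; rewrite big_cons.
  rewrite ltr_wpDr ?sumr_ge0// => [*|]; first exact: sqr_ge0.
  by rewrite exprn_even_gt0//= cJ// inE eqxx.
under eq_fun do rewrite big_cons.
rewrite !big_cons.
have -> : Num.sqrt (c i ^+ 2 + \sum_(j <- J) c j ^+ 2) * `|s| =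
    Num.sqrt ((`|c i| * `|s|) ^+ 2 +
       (Num.sqrt (\sum_(j <- J) c j ^+ 2) * `|s|) ^+ 2).
  rewrite !exprMn sqr_sqrtr ?(ltW sumc0)// -mulrDl sqrtrM ?addr_ge0 ?sqr_ge0// ?ltW//.
  by rewrite real_normK ?num_real// sqrtr_sqr normr_id.
have mXi : measurable_fun setT (fun w => c i * X i w).
  by apply: measurable_funM => //; exact: measurable_family.
have mJ := depends_on_measurable (@depends_on_lin J c).
have s10 : `|c i| * `|s| != 0 by rewrite mulf_neq0 ?normr_eq0.
have s20 : Num.sqrt (\sum_(j <- J) c j ^+ 2) * `|s| != 0.
  by rewrite mulf_neq0 ?normr_eq0// gt_eqF// sqrtr_gt0.
apply: (has_lawD mXi mJ s10 s20 lXi).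
  by apply: IH => j jJ; apply: lX; rewrite inE jJ orbT.
apply: (@depends_on_indep [:: i] J); first by rewrite /= iJ.
  by apply: (@depends_on_comp _ (fun x => c i * x));
    [exact: measurable_funM|exact: depends_on_X].
exact: depends_on_lin.
Qed.

Lemma integral_prod_blocks (K : eqType) (blk : K -> seq I) (V : K -> T -> R)
    (F : K -> R -> R) (ks : seq K) :
  uniq (flatten [seq blk k | k <- ks]) ->
  (forall k, depends_on (blk k) (V k)) ->
  (forall k, measurable_fun setT (F k)) -> (forall k x, 0 <= F k x) ->
  (\int[P]_w (\prod_(k <- ks) F k (V k w))%:E =
   \prod_(k <- ks) \int[P]_w (F k (V k w))%:E)%E.
Proof.
move=> uk dV mF F0; elim: ks uk => [|k ks IH] uk.
  under eq_integral do rewrite big_nil.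
  by rewrite big_nil integral_cst// mul1e; exact: probability_setT.
have dU : depends_on (flatten [seq blk k | k <- ks])
    (fun w => \prod_(k <- ks) F k (V k w)).
  elim: ks {IH uk} => [|k' ks IH] /=.
    by under eq_fun do rewrite big_nil; exact: measurable_cst.
  rewrite (_ : (fun w => _) =
      fun w => F k' (V k' w) * \prod_(k <- ks) F k (V k w)); last first.
    by apply/funext => w; rewrite big_cons.
  apply: measurable_funM.
    apply: (@depends_on_sub (blk k')); first by move=> i; rewrite mem_cat => ->.
    exact: (depends_on_comp (mF k') (dV k')).
  by apply: depends_on_sub IH => i ik; rewrite mem_cat ik orbT.
rewrite big_cons -IH; last by move: uk; rewrite /= cat_uniq => /and3P[].
under eq_integral do rewrite big_cons.
(* [indep2_integralM] wants a function that is nonnegative on the whole line, so the nonnegative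
   product [U] is read as its own absolute value. *)
pose U w := \prod_(k <- ks) F k (V k w).
have U0 w : 0 <= U w by apply: prodr_ge0.
have -> : (\int[P]_w (\prod_(j <- ks) F j (V j w))%:E =
           \int[P]_w (`|U w|)%:E)%E.
  by apply: eq_integral => w _; rewrite ger0_norm.
rewrite -(@indep2_integralM _ _ _ P (V k) U (F k) Num.norm)//.
- by apply: eq_integral => w _; rewrite ger0_norm.
- exact: depends_on_measurable (dV k).
- exact: depends_on_measurable dU.
- exact: (depends_on_indep uk (dV k) dU).
Qed.

End grouping.

(** * Gaussian tails and moment generating functions *)

Section exp_inequalities.
Context (R : realType).
Implicit Types x y : R.

Lemma expR_le_inv y : y < 1 -> expR y <= (1 - y)^-1.
Proof.
move=> y1; rewrite -[leLHS]invrK -expRN lef_pV2 ?posrE ?expR_gt0 ?subr_gt0//.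
exact: expR_ge1Dx.
Qed.

(** For y >= 0, apply e^y <= 1 + y e^y twice. For y < 0, e^y <= 1/(1-y) <= 1 + y + y^2, because
    (1-y)(1+y+y^2) = 1 - y^3 >= 1. *)
Lemma expR_le_1DxDsqr y : expR y <= 1 + y + y ^+ 2 * expR `|y|.
Proof.
have [y0|y0] := leP 0 y.
  have h : expR y <= 1 + y * expR y.
    have := expR_ge1Dx (- y); rewrite expRN => h.
    have e0 := expR_gt0 y.
    have : (1 - y) * expR y <= 1 by rewrite -ler_pdivlMr// div1r.
    by rewrite mulrBl mul1r lerBlDr.
  rewrite ger0_norm//; apply: (le_trans h).
  by rewrite -addrA lerD2l expr2 -mulrA -[X in X + _]mulr1 -mulrDr ler_wpM2l.
have e1 : 1 <= expR `|y| by rewrite -expR0 ler_expR.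
have y1 : y < 1 by lra.
apply: (le_trans (expR_le_inv y1)).
have h : 1 + y + y ^+ 2 <= 1 + y + y ^+ 2 * expR `|y|.
  by rewrite lerD2l ler_peMr// sqr_ge0.
apply: le_trans h; rewrite -div1r ler_pdivrMr ?subr_gt0//.
have : 0 <= (- y) * y ^+ 2 by rewrite mulr_ge0 ?sqr_ge0// oppr_ge0 ltW.
by move=> h; rewrite (_ : _ * _ = 1 + (- y) * y ^+ 2); [lra|ring].
Qed.

Lemma expR1_le3 : expR 1 <= 3 :> R.
Proof.
have u : expR (1 / 8) <= 8 / 7 :> R.
  have e1 : (1 / 8 : R) < 1 by lra.
  apply: (le_trans (expR_le_inv e1)).
  by rewrite (_ : 1 - 1 / 8 = 7 / 8) ?invf_div//; lra.
(* e is the eighth power of e^(1/8) <= 8/7, and (8/7)^8 is just below 3. *)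
have -> : (1 : R) = 8%:R * (1 / 8) by lra.
rewrite expRM_natl; apply: (@le_trans _ _ ((8 / 7) ^+ 8)).
  by rewrite lerXn2r// nnegrE ?expR_ge0//; lra.
by lra.
Qed.

(* The constant comes from [|r - b| <= r + 8], [r ^+ 2 <= 128 * expR (r / 8)]
   and [expR 1 <= 3]. *)
Lemma expR_quad_bound (th r b : R) : 0 <= r -> 0 <= b <= 8 -> `|th| <= 1 / 8 ->
  expR (th * (r - b)) <= 1 + th * (r - b) + th ^+ 2 * (576 * expR (r / 4)).
Proof.
move=> r0 /andP[b0 b8] th8.
apply: (le_trans (expR_le_1DxDsqr _)); rewrite lerD2l exprMn -mulrA.
apply: ler_wpM2l; first exact: sqr_ge0.
have absrb : `|r - b| <= r + 8 by rewrite ler_norml; lra.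
have h1 : expR `|th * (r - b)| <= 3 * expR (r / 8).
  apply: (@le_trans _ _ (expR (1 + r / 8))).
    rewrite ler_expR normrM (@le_trans _ _ (1 / 8 * (r + 8)))//; last by lra.
    by apply: ler_pM.
  by rewrite expRD ler_wpM2r ?expR_ge0// expR1_le3.
have h2 : (r - b) ^+ 2 <= 192 * expR (r / 8).
  have := @expR_ge1Dxn R (r / 8) 1 _; rewrite divr_ge0// => /(_ isT).
  have e8 : (8 : R) ^+ 2 = 64 by lra.
  move: (expR _) => e; rewrite expr_div_n e8 (_ : 2`!%:R = 2 :> R)// => h.
  have : (r - b) ^+ 2 <= r ^+ 2 + 64 by nra.
  have := sqr_ge0 r; move: (r ^+ 2) h ((r - b) ^+ 2) => *; lra.
have -> : 576 * expR (r / 4) = (192 * expR (r / 8)) * (3 * expR (r / 8)) :> R.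
  have -> : r / 4 = r / 8 + r / 8 by lra.
  by rewrite expRD; ring.
by apply: ler_pM => //; rewrite ?sqr_ge0 ?expR_ge0.
Qed.

(** Squared and inverted, this is e^(y - y^2) <= 1 + y, which follows from (1+y)(1-y+y^2) = 1 +
    y^3. *)
Lemma invsqrt_le_expR y : 0 <= y <= 1 ->
  (Num.sqrt (1 + y))^-1 <= expR ((y ^+ 2 - y) / 2).
Proof.
move=> /andP[y0 y1].
have h : expR (y - y ^+ 2) <= 1 + y.
  have z1 : y - y ^+ 2 < 1 by nra.
  apply: (le_trans (expR_le_inv z1)); rewrite -div1r ler_pdivrMr ?subr_gt0//.
  rewrite (_ : _ * _ = 1 + y ^+ 3); last by ring.
  by rewrite lerDl exprn_ge0.
have -> : (y ^+ 2 - y) / 2 = - ((y - y ^+ 2) / 2) by lra.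
rewrite expRN lef_pV2 ?posrE ?expR_gt0 ?sqrtr_gt0//; last by lra.
rewrite -[leLHS]ger0_norm ?expR_ge0// -sqrtr_sqr ler_wsqrtr//.
by rewrite -expRM_natl (_ : 2%:R * _ = y - y ^+ 2)//; field.
Qed.

Lemma invsqrt_le_1DxDsqr y : 0 <= y <= 1 / 4 ->
  (Num.sqrt (1 - 2 * y))^-1 <= 1 + y + 4 * y ^+ 2.
Proof.
move=> /andP[y0 y1].
have a0 : 0 < 1 + y + 4 * y ^+ 2 by nra.
have s0 : 0 < Num.sqrt (1 - 2 * y) by rewrite sqrtr_gt0; lra.
rewrite -div1r ler_pdivrMr//.
have -> : (1 + y + 4 * y ^+ 2) * Num.sqrt (1 - 2 * y) =
    Num.sqrt ((1 + y + 4 * y ^+ 2) ^+ 2 * (1 - 2 * y)).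
  by rewrite sqrtrM ?sqr_ge0// sqrtr_sqr ger0_norm// ltW.
rewrite -[X in X <= _]sqrtr1 ler_wsqrtr//.
have -> : (1 + y + 4 * y ^+ 2) ^+ 2 * (1 - 2 * y) =
   1 + y ^+ 2 * ((5 - 10 * y - 32 * y ^+ 3)) by ring.
rewrite lerDl mulr_ge0 ?sqr_ge0//.
have : y ^+ 3 <= (1 / 4) ^+ 3 by rewrite lerXn2r// nnegrE; lra.
by lra.
Qed.

End exp_inequalities.

Section gaussian_tails.
Context (R : realType).
Implicit Types a x y th m : R.
Local Notation Q := (normal_prob (0 : R) 1).
Local Notation tail a := (tail_set (a : R)).

(** The tilted density is a constant times the normal density with mean m/b and variance 1/b, where
    b = 1 + 2 th. Negative [th] above -1/2 is allowed, and is used for the tail bound and for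
    [nu0_le1]. *)
Lemma integral_normal_expsqr m th : 0 < 1 + 2 * th ->
  (\int[normal_prob m 1]_x (expR (- th * x ^+ 2))%:E =
   ((Num.sqrt (1 + 2 * th))^-1 * expR (- th * m ^+ 2 / (1 + 2 * th)))%:E)%E.
Proof.
move=> b0; set b := 1 + 2 * th in b0 *.
have mexp : measurable_fun setT (fun x : R => expR (- th * x ^+ 2)).
  apply: (measurableT_comp (@measurable_expR R)).
  by apply: measurable_funM => //; exact: measurable_funX.
rewrite (@ge0_integral_normal_prob _ _ _ (fun x => (expR (- th * x ^+ 2))%:E))//; last first.
  exact/measurable_EFinP.
pose c := (Num.sqrt b)^-1 * expR (- th * m ^+ 2 / b).
pose s := (Num.sqrt b)^-1.
have s0 : s != 0 by rewrite invr_eq0 gt_eqF// sqrtr_gt0.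
have sE : s ^+ 2 = b^-1 by rewrite /s exprVn sqr_sqrtr// ltW.
have cE x : expR (- th * x ^+ 2) * normal_pdf m 1 x = c * normal_pdf (m / b) s x.
  rewrite !normal_pdfE ?oner_neq0// /normal_peak /normal_fun /c sE.
  rewrite mulrCA -expRD [RHS]mulrACA -expRD -invfM -sqrtrM ?ltW//.
  congr (_^-1 * expR _).
    by congr Num.sqrt; move: (pi : R) => q; field; rewrite gt_eqF.
  by rewrite /b; field; rewrite -/b gt_eqF.
under eq_integral => x _ do rewrite -EFinM cE.
rewrite ge0_integral_realZ ?integral_normal_pdf ?mule1//.
- exact: measurable_normal_pdf.
- by move=> x; exact: normal_pdf_ge0.
- by rewrite mulr_ge0 ?expR_ge0// invr_ge0 sqrtr_ge0.
Qed.

(** [e] is a sign, 1 or -1; the parameter treats both rays of the two-sided tail at once. *)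
Definition halftail (e a : R) : set R := [set x | a < e * x].

Lemma measurable_halftail e a : measurable (halftail e a).
Proof.
have mf : measurable_fun setT (fun x : R => e * x) by exact: measurable_funM.
have -> : halftail e a = setT `&` (fun x : R => e * x) @^-1` `]a, +oo[%classic.
  by rewrite setTI; apply/seteqP; split => x /=; rewrite in_itv/= andbT.
exact: mf.
Qed.

Lemma tail_halves a : tail a = halftail 1 a `|` halftail (-1) a.
Proof.
apply/seteqP; split => x; rewrite /tail_set /halftail /= mul1r mulN1r.
  by rewrite ltrNr lter_normr => /orP[]; [left|right] => //; rewrite ltrNr.
by rewrite lter_normr => -[->|->]; rewrite ?orbT.
Qed.

Lemma halftail_disjoint a : 0 <= a -> [disjoint halftail 1 a & halftail (-1) a].
Proof.
move=> a0; apply/disj_setPS => x [] /=; rewrite /halftail/= mul1r mulN1r => h1 h2.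
by exfalso; move: h1 h2 a0; lra.
Qed.

Lemma measurable_tail a : measurable (tail a).
Proof. by rewrite tail_halves; apply: measurableU; exact: measurable_halftail. Qed.

Lemma measurable_tilt a : measurable_fun setT (fun x : R => expR ((x ^+ 2 - a ^+ 2) / 4)).
Proof.
apply: (measurableT_comp (@measurable_expR R)).
by apply: measurable_funM => //; apply: measurable_funB => //; exact: measurable_funX.
Qed.

(* Substituting [x := 2 * y - e * a], which maps the half tail onto itself. *)
Lemma integral_halftail_tilt e a : e ^+ 2 = 1 -> 0 <= a ->
  (\int[Q]_(x in halftail e a) (expR ((x ^+ 2 - a ^+ 2) / 4))%:E
   <= 2%:E * Q (halftail e a))%E.
Proof.
move=> e1 a0; have mS := measurable_halftail e a.
have mt := measurable_tilt a.
rewrite ge0_integral_normal_prob//; last exact/measurable_EFinP/measurable_funTS.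
under eq_integral do rewrite -EFinM.
have gE (f : R -> R) : (\int[lebesgue_measure]_(x in halftail e a) (f x)%:E =
    \int[lebesgue_measure]_x (\1_(halftail e a) x * f x)%:E)%E.
  rewrite integral_mkcond; apply: eq_integral => x _.
  by rewrite patchE indicE; case: ifP => _; rewrite ?mul1r ?mul0r.
rewrite gE /normal_prob gE.
have mi : measurable_fun setT (\1_(halftail e a) : R -> R) by exact: measurable_indic.
have mp := @measurable_normal_pdf R 0 1.
rewrite (@ge0_integral_affine _ 2 (- (e * a)))//; last 2 first.
- apply/measurable_EFinP/measurable_funM => //; exact: measurable_funM.
- by move=> x; rewrite lee_fin !mulr_ge0// ?expR_ge0// normal_pdf_ge0.
rewrite (@ger0_norm _ 2)// lee_pmul2l//.
apply: ge0_le_integral => //.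
- by move=> x _; rewrite lee_fin !mulr_ge0// ?expR_ge0// normal_pdf_ge0.
- apply/measurable_EFinP.
  apply: (@measurableT_comp _ _ _ _ _ _ (fun x => \1_(halftail e a) x * (expR ((x ^+ 2 - a ^+ 2) / 4) * normal_pdf 0 1 x))).
    by apply: measurable_funM => //; exact: measurable_funM.
  exact: affine_measurable.
- by apply/measurable_EFinP/measurable_funM.
move=> x _; rewrite lee_fin.
(* The substitution doubles the distance e x - a to the endpoint and so keeps its sign. *)
have -> : \1_(halftail e a) (2 * x + - (e * a)) = \1_(halftail e a) x :> R.
  have eE : e * (2 * x + - (e * a)) = 2 * (e * x) - a.
    by rewrite (_ : _ * _ = 2 * (e * x) - e ^+ 2 * a); [rewrite e1 mul1r|ring].
  by rewrite !indicE; congr (nat_of_bool _)%:R; apply/idP/idP;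
    rewrite !inE /halftail/= eE; lra.
rewrite ler_wpM2l//.
rewrite !normal_pdfE ?oner_neq0// mulrCA ler_wpM2l ?normal_peak_ge0//.
rewrite /normal_fun -expRD ler_expR !subr0.
(* The gap between the two exponents is exactly half of this square. *)
have : 0 <= (x - e * a) ^+ 2 by exact: sqr_ge0.
have -> : (x - e * a) ^+ 2 = x ^+ 2 - 2 * e * a * x + a ^+ 2.
  by rewrite sqrrB exprMn e1; ring.
move=> h.
have -> : (2 * x + - (e * a)) ^+ 2 = 4 * x ^+ 2 - 4 * e * a * x + a ^+ 2.
  by rewrite sqrrB exprMn [(e * a) ^+ 2]exprMn e1; ring.
rewrite !expr1n -!mulrA; move: h; lra.
Qed.

Lemma integral_tailD a (f : R -> \bar R) : 0 <= a ->
  measurable_fun setT f -> (forall x, 0 <= f x)%E ->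
  (\int[Q]_(x in tail a) f x =
   \int[Q]_(x in halftail 1 a) f x + \int[Q]_(x in halftail (-1) a) f x)%E.
Proof.
move=> a0 mf f0; rewrite tail_halves ge0_integral_setU//.
- exact: measurable_halftail.
- exact: measurable_halftail.
- exact: measurable_funTS.
- exact: halftail_disjoint.
Qed.

Lemma integral_tail_tilt a : 0 <= a ->
  (\int[Q]_(x in tail a) (expR ((x ^+ 2 - a ^+ 2) / 4))%:E <= 2%:E * Q (tail a))%E.
Proof.
move=> a0.
have mt : measurable_fun setT (fun x : R => (expR ((x ^+ 2 - a ^+ 2) / 4))%:E).
  by apply/measurable_EFinP; exact: (measurable_tilt a).
have t0 x : (0 <= (expR ((x ^+ 2 - a ^+ 2) / 4))%:E)%E by rewrite lee_fin expR_ge0.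
rewrite (integral_tailD a0 mt t0).
have -> : (Q (tail a) = Q (halftail 1 a) + Q (halftail (-1) a))%E.
  rewrite tail_halves measureU//; try exact: measurable_halftail.
  by apply/disj_set2P; exact: halftail_disjoint.
rewrite muleDr//; last by rewrite ge0_adde_def// inE measure_ge0.
by apply: leeD; apply: integral_halftail_tilt; rewrite ?expr1n ?sqrrN ?expr1n.
Qed.

Definition qtail a : R := fine (Q (tail a)).

Lemma qtailE a : Q (tail a) = (qtail a)%:E.
Proof. by rewrite /qtail fineK// fin_num_measure//; exact: measurable_tail. Qed.

Lemma qtail_le1 a : qtail a <= 1.
Proof. by rewrite -lee_fin -qtailE probability_le1//; exact: measurable_tail. Qed.

(** Makes the quotient in [nu] a genuine conditional mean. On the unit interval to the right of [a]
    the density is at least its value at a + 1. *)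
Lemma qtail_gt0 a : 0 <= a -> 0 < qtail a.
Proof.
move=> a0; rewrite -lte_fin -qtailE.
pose J : set R := `]a, (a + 1)%R]%classic.
have s1 : J `<=` tail a.
  move=> x; rewrite /J/= in_itv/= /tail_set/= => /andP[ax _].
  by rewrite gtr0_norm//; exact: le_lt_trans ax.
have : (0 < Q J)%E.
  pose c := normal_pdf 0 1 (a + 1).
  have c0 : 0 < c.
    by rewrite /c normal_pdfE ?oner_neq0// mulr_gt0 ?expR_gt0// normal_peak_gt0 ?oner_neq0.
  apply: (@lt_le_trans _ _ (\int[lebesgue_measure]_(x in J) c%:E)%E).
    have lJ : lebesgue_measure J = 1%E.
      by rewrite /J lebesgue_measure_itv/= lte_fin ltrDl ltr01 -EFinD addrAC subrr add0r.
    have mJ : @measurable _ (measurableTypeR R) J by exact: measurable_itv.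
    rewrite integral_cst; last exact: mJ.
    by rewrite [X in (_ * X)%E](_ : _ = 1%E) ?mule1 ?lte_fin.
  rewrite /J; apply: ge0_le_integral => //.
  - by move=> x _; rewrite lee_fin ltW.
  - by apply/measurable_EFinP/measurable_funTS; exact: measurable_normal_pdf.
  move=> x; rewrite /J/= in_itv/= lee_fin => /andP[ax xa].
  rewrite /c !normal_pdfE ?oner_neq0// ler_wpM2l ?normal_peak_ge0//.
  rewrite /normal_fun ler_expR !subr0 !mulNr lerN2 ler_wpM2r ?invr_ge0//.
  by rewrite lerXn2r// nnegrE; lra.
move=> /lt_le_trans; apply; apply: le_measure; rewrite ?inE; [exact: measurable_itv|exact: (measurable_tail a)|exact: s1].
Qed.

(** Markov for exp(Z^2/4), whose mean sqrt 2 is at most 3/2. The rate a^2/4 matches the factor 4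
    inside [thr]: there the bound becomes 3/2 divided by the argument of the logarithm. *)
Lemma qtail_le a : 0 <= a -> qtail a <= 3 / 2 * expR (- (a ^+ 2 / 4)).
Proof.
move=> a0; rewrite -lee_fin -qtailE.
have := @integral_normal_expsqr 0 (- (1 / 4)) _.
rewrite expr0n/= mulr0 mul0r expR0 mulr1 => h.
have half : 1 + 2 * - (1 / 4) = 1 / 2 :> R by lra.
rewrite half in h.
have {}h : (\int[Q]_x (expR (1 / 4 * x ^+ 2))%:E = ((Num.sqrt (1 / 2))^-1)%:E)%E.
  by rewrite -h ?opprK//; lra.
have s2 : (Num.sqrt (1 / 2))^-1 <= 3 / 2 :> R.
  have s0 : 0 < Num.sqrt (1 / 2) :> R by rewrite sqrtr_gt0; lra.
  rewrite -div1r ler_pdivrMr// -ler_pdivrMl; last by lra.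
  rewrite mulr1 -[leLHS]ger0_norm; last by rewrite invr_ge0; lra.
  by rewrite -sqrtr_sqr ler_wsqrtr// invf_div; lra.
have -> : (Q (tail a) = \int[Q]_(x in tail a) (1 : R)%:E)%E.
  by rewrite integral_cst ?mul1e//; exact: measurable_tail.
apply: (@le_trans _ _ (\int[Q]_x ((expR (- (a ^+ 2 / 4)) * expR (1 / 4 * x ^+ 2))%:E))%E).
  rewrite integral_mkcond.
  apply: ge0_le_integral => //.
  - by move=> x _; rewrite patchE; case: ifP => _; rewrite lee_fin.
  - apply/(measurable_restrictT _ _).1; first exact: measurable_tail.
    exact: measurable_cst.
  - apply/measurable_EFinP/measurable_funM => //.
    apply: (measurableT_comp (@measurable_expR R)).
    by apply: measurable_funM => //; exact: measurable_funX.
  move=> x _; rewrite patchE; case: ifP => [|_]; last first.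
    by rewrite lee_fin mulr_ge0 ?expR_ge0.
  rewrite inE /tail_set/= lee_fin => ax.
  rewrite -expRD -[X in X <= _]expR0 ler_expR.
  have : a ^+ 2 <= x ^+ 2 by rewrite -[leRHS]real_normK ?num_real// lerXn2r// ?nnegrE ?ltW// (le_lt_trans a0).
  by lra.
rewrite ge0_integral_realZ ?expR_ge0//.
  by rewrite h -EFinM lee_fin mulrC ler_wpM2r ?expR_ge0.
apply: (measurableT_comp (@measurable_expR R)).
by apply: measurable_funM => //; exact: measurable_funX.
Qed.

End gaussian_tails.

Section ge0_integral_real.
Context d (T : measurableType d) (R : realType).
Context (mu : {finite_measure set T -> \bar R}) (D : set T) (mD : measurable D).
Implicit Types f g : T -> R.
Local Notation I f := (\int[mu]_(x in D) (f x)%:E)%E.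

Lemma real_integral_le f g : measurable_fun setT f -> measurable_fun setT g ->
  (forall x, 0 <= f x) -> (forall x, D x -> f x <= g x) -> (I f <= I g)%E.
Proof.
move=> mf mg f0 fg; apply: ge0_le_integral => //.
- by move=> x _; rewrite lee_fin.
- exact/measurable_EFinP/measurable_funTS.
- exact/measurable_EFinP/measurable_funTS.
Qed.

Lemma real_integralD f g : measurable_fun setT f -> measurable_fun setT g ->
  (forall x, 0 <= f x) -> (forall x, 0 <= g x) ->
  (I (fun x => f x + g x)%R = I f + I g)%E.
Proof.
move=> mf mg f0 g0; under eq_integral do rewrite EFinD.
rewrite ge0_integralD//.
- by move=> x _; rewrite lee_fin.
- exact/measurable_EFinP/measurable_funTS.
- by move=> x _; rewrite lee_fin.
- exact/measurable_EFinP/measurable_funTS.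
Qed.

Lemma real_integralZ c f : measurable_fun setT f -> (forall x, 0 <= f x) ->
  0 <= c -> (I (fun x => c * f x)%R = c%:E * I f)%E.
Proof.
move=> mf f0 c0; under eq_integral do rewrite EFinM.
rewrite ge0_integralZl//.
- exact/measurable_EFinP/measurable_funTS.
- by move=> x _; rewrite lee_fin.
Qed.

Lemma real_integral_cst c : (I (fun=> c) = (c * fine (mu D))%:E)%E.
Proof. by rewrite integral_cst// EFinM fineK// fin_num_measure. Qed.

End ge0_integral_real.

(** * Moments and exponential moments of the truncated square *)

Section truncated_square.
Context (R : realType).
Implicit Types a x th m : R.
Local Notation Q := (normal_prob (0 : R) 1).
Local Notation tail a := (tail_set (a : R)).
Local Notation I a f := (\int[Q]_(x in tail a) (f x)%:E)%E.

Lemma measurable_sqr : measurable_fun setT (fun x : R => x ^+ 2).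
Proof. exact: measurable_funX. Qed.

Lemma tail_sqr a x : 0 <= a -> tail a x -> a ^+ 2 <= x ^+ 2.
Proof.
rewrite /tail_set/= => a0 ax.
by rewrite -[leRHS]real_normK ?num_real// lerXn2r// ?nnegrE ?ltW// (le_lt_trans a0).
Qed.

(** On the tail x^2 <= a^2 + 4 exp((x^2 - a^2)/4), and the tilt bound integrates the exponential to
    at most 2 q; hence 8 = 4 times 2. *)
Lemma tail_moment_le a : 0 <= a ->
  (I a (fun x => x ^+ 2) <= ((a ^+ 2 + 8) * qtail a)%:E)%E.
Proof.
move=> a0; have mt := measurable_tail a; have ms := measurable_sqr.
have me := measurable_tilt a.
apply: (@le_trans _ _ (I a (fun x => a ^+ 2 + 4 * expR ((x ^+ 2 - a ^+ 2) / 4)))).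
  apply: real_integral_le => //.
  - by apply: measurable_funD => //; exact: measurable_funM.
  - by move=> x; exact: sqr_ge0.
  - by move=> x _; have := expR_ge1Dx ((x ^+ 2 - a ^+ 2) / 4); lra.
have m4 : measurable_fun setT (fun x => 4 * expR ((x ^+ 2 - a ^+ 2) / 4)).
  exact: measurable_funM.
have p4 x : 0 <= 4 * expR ((x ^+ 2 - a ^+ 2) / 4) by rewrite mulr_ge0// expR_ge0.
have p0 (x : R) : 0 <= a ^+ 2 by exact: sqr_ge0.
rewrite (@real_integralD _ _ _ Q (tail a) mt (fun=> a ^+ 2)
  (fun x => 4 * expR ((x ^+ 2 - a ^+ 2) / 4)) (measurable_cst _) m4 p0 p4).
rewrite (@real_integralZ _ _ _ Q (tail a) mt 4 (fun x => expR ((x ^+ 2 - a ^+ 2) / 4)))//.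
rewrite real_integral_cst// [X in (_ <= X%:E)%E]mulrDl [X in (_ <= X)%E]EFinD.
apply: leeD; first by rewrite lee_fin.
apply: (@le_trans _ _ (4%:E * (2%:E * Q (tail a)))%E).
  by rewrite lee_pmul2l//; exact: integral_tail_tilt.
by rewrite qtailE -!EFinM lee_fin; clear p0 p4; lra.
Qed.

Lemma tail_momentE a : 0 <= a ->
  I a (fun x => x ^+ 2) = (nu a * qtail a)%:E.
Proof.
move=> a0; have q0 := qtail_gt0 a0.
rewrite /nu -/(qtail a) divfK ?gt_eqF// fineK//.
rewrite ge0_fin_numE; last by apply: integral_ge0 => x _; rewrite lee_fin sqr_ge0.
by apply: (le_lt_trans (tail_moment_le a0)); rewrite ltry.
Qed.

(** With [nu_ge] this places nu a - a^2 in [0, 8], the range of [b] in [expR_quad_bound]. *)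
Lemma nu_le a : 0 <= a -> nu a <= a ^+ 2 + 8.
Proof.
move=> a0; have := tail_moment_le a0; rewrite tail_momentE// lee_fin.
by rewrite ler_pM2r// qtail_gt0.
Qed.

Lemma nu_ge a : 0 <= a -> a ^+ 2 <= nu a.
Proof.
move=> a0; rewrite -(ler_pM2r (qtail_gt0 a0)) -lee_fin -tail_momentE//.
rewrite -(real_integral_cst Q (measurable_tail a)).
apply: real_integral_le => //; first exact: measurable_tail.
- by move=> x; exact: sqr_ge0.
- by move=> x; exact: tail_sqr.
Qed.

Lemma qtailC a : Q (~` tail a) = (1 - qtail a)%:E.
Proof. rewrite EFinB -qtailE; by apply: probability_setC; exact: (measurable_tail a). Qed.

(** Read off from the exponential moment: 1 + th nu 0 <= E exp(th Z^2) = (1 - 2 th)^(-1/2) <= 1 + th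
    + 4 th^2, with [th] tending to 0. At threshold 0 it makes the centring term nu - 1 of the lower
    tail nonpositive. *)
Lemma nu0_le1 : nu 0 <= 1 :> R.
Proof.
have q1 : qtail 0 = 1 :> R.
  have m0 := measurable_tail (0 : R).
  have : (Q (~` tail 0) = 0)%E.
    have -> : ~` tail 0 = [set (0 : R)].
      apply/seteqP; split => x; rewrite /tail_set/= normr_gt0.
        by move=> /negP; rewrite negbK => /eqP.
      by move=> ->; rewrite eqxx.
    by rewrite /normal_prob integral_set1.
  rewrite qtailC => -[] h.
  by move: h; lra.
suff h th : 0 < th <= 1 / 8 -> nu 0 <= 1 + 4 * th.
  apply/ler_addgt0Pr => e e0; have [e8|e8] := leP (e / 4) (1 / 8).
    by apply: (le_trans (h (e / 4) _)); lra.
  by apply: (le_trans (h (1 / 8) _)); lra.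
move=> /andP[t0 t8].
have mT := @measurableT _ (measurableTypeR R).
have ms := measurable_sqr.
have h1 : 1 + 2 * - th > 0 by lra.
have := @integral_normal_expsqr R 0 (- th) h1.
rewrite expr0n/= mulr0 mul0r expR0 mulr1 opprK => h2.
have h3 : ((1 + th * nu 0)%:E <= \int[Q]_x (expR (th * x ^+ 2))%:E)%E.
  apply: (@le_trans _ _ (\int[Q]_x (1 + th * x ^+ 2)%:E)%E); last first.
    apply: real_integral_le => //.
    - by apply: measurable_funD => //; exact: measurable_funM.
    - apply: (measurableT_comp (@measurable_expR R)).
      exact: measurable_funM.
    - by move=> x; rewrite addr_ge0// mulr_ge0 ?sqr_ge0// ltW.
    - by move=> x _; exact: expR_ge1Dx.
  rewrite (@real_integralD _ _ _ Q setT mT (fun=> 1) (fun x => th * x ^+ 2))//; last 2 first.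
  - exact: measurable_funM.
  - by move=> x; rewrite mulr_ge0 ?sqr_ge0// ltW.
  rewrite real_integral_cst// [X in fine X](_ : _ = 1%E); last exact: probability_setT.
  rewrite mulr1 EFinD leeD2l//.
  rewrite (@real_integralZ _ _ _ Q setT mT th (fun x => x ^+ 2))//; last 2 first.
  - by move=> x; exact: sqr_ge0.
  - exact: ltW.
  rewrite EFinM lee_pmul2l//.
  have := tail_momentE (lexx (0 : R)); rewrite q1 mulr1 => <-.
  apply: ge0_subset_integral => //.
  - exact: measurable_tail.
  - exact/measurable_EFinP.
  - by move=> x _; rewrite lee_fin sqr_ge0.
rewrite h2 lee_fin mulrN in h3.
have h4 : 1 + th * nu 0 <= 1 + th + 4 * th ^+ 2.
  by apply: (le_trans h3); apply: invsqrt_le_1DxDsqr; lra.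
by rewrite -(ler_pM2l t0); lra.
Qed.

Definition trunc a x : R := if a < `|x| then x ^+ 2 - nu a else 0.

Lemma measurable_trunc a : measurable_fun setT (trunc a).
Proof.
apply: measurable_fun_ifT => //.
  by apply: measurable_fun_ltr => //; exact: measurableT_comp.
by apply: measurable_funB => //; exact: measurable_funX.
Qed.

(** Below the threshold x^2 <= a^2 <= nu a, so the left side is nonpositive while [trunc] is 0. *)
Lemma trunc_ge a x : 0 <= a -> x ^+ 2 - nu a <= trunc a x.
Proof.
move=> a0; rewrite /trunc; case: ltP => // xa.
have : x ^+ 2 <= a ^+ 2 by rewrite -[leLHS]real_normK ?num_real// lerXn2r// nnegrE.
by have := nu_ge a0; lra.
Qed.

(* Writing the exponent as a difference [u - v] keeps all integrands
   nonnegative; the linear term integrates to 0 by definition of [nu]. *)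
Lemma tail_mgf a u v : 0 <= a -> 0 <= u -> 0 <= v -> `|u - v| <= 1 / 8 ->
  (I a (fun x => expR ((u - v) * (x ^+ 2 - nu a))) <=
   (qtail a + 1152 * (u - v) ^+ 2 * qtail a)%:E)%E.
Proof.
move=> a0 u0 v0 uv8; have mt := measurable_tail a; have ms := measurable_sqr.
have me := measurable_tilt a.
have n0 : 0 <= nu a by apply: le_trans (nu_ge a0); exact: sqr_ge0.
set th := u - v in uv8 *.
pose e x := expR ((x ^+ 2 - a ^+ 2) / 4).
pose c := (u + v) * nu a.
have mE : measurable_fun setT (fun x => expR (th * (x ^+ 2 - nu a))).
  apply: (measurableT_comp (@measurable_expR R)).
  by apply: measurable_funM => //; exact: measurable_funB.
have muX w : measurable_fun setT (fun x : R => w * x ^+ 2) by exact: measurable_funM.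
have X0 w x : 0 <= w -> 0 <= w * x ^+ 2 by move=> w0; rewrite mulr_ge0// sqr_ge0.
have sq0 : 0 <= 576 * th ^+ 2.
  by apply: mulr_ge0; [exact: ler0n|exact: sqr_ge0].
have mRe : measurable_fun setT (fun x => 576 * th ^+ 2 * e x) by exact: measurable_funM.
have e0 x : 0 <= 576 * th ^+ 2 * e x by rewrite mulr_ge0// expR_ge0.
have un0 : 0 <= u * nu a by rewrite mulr_ge0.
have vn0 : 0 <= v * nu a by rewrite mulr_ge0.
have mL := measurable_funD (measurable_cst (u * nu a)) (muX v).
have mR := measurable_funD (measurable_cst (1 + v * nu a)) (measurable_funD (muX u) mRe).
have key : (I a (fun x => (expR (th * (x ^+ 2 - nu a)) + (u * nu a + v * x ^+ 2))%R) <=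
   I a (fun x => ((1 + v * nu a) + (u * x ^+ 2 + 576 * th ^+ 2 * e x))%R))%E.
  apply: real_integral_le => //.
  - exact: (measurable_funD mE mL).
  - by move=> x; rewrite !addr_ge0 ?expR_ge0// X0.
  move=> x ax; have := tail_sqr a0 ax => axs.
  have := @expR_quad_bound R th (x ^+ 2 - a ^+ 2) (nu a - a ^+ 2) _ _ uv8.
  have -> : x ^+ 2 - a ^+ 2 - (nu a - a ^+ 2) = x ^+ 2 - nu a by ring.
  rewrite -/(e x) => h.
  have b1 : 0 <= x ^+ 2 - a ^+ 2 by rewrite subr_ge0.
  have b2 : 0 <= nu a - a ^+ 2 <= 8.
    by rewrite subr_ge0 nu_ge//= lerBlDr addrC nu_le.
  have {h b1 b2} := h b1 b2; move: (expR _) (e x) => E1 E2.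
  by rewrite /th; lra.
have pE x : 0 <= expR (th * (x ^+ 2 - nu a)) by exact: expR_ge0.
have pu (x : R) : 0 <= u * x ^+ 2 by exact: X0.
have pv (x : R) : 0 <= v * x ^+ 2 by exact: X0.
have pL (x : R) : 0 <= u * nu a + v * x ^+ 2 by rewrite addr_ge0.
have pR (x : R) : 0 <= u * x ^+ 2 + 576 * th ^+ 2 * e x by rewrite addr_ge0.
have v10 : 0 <= 1 + v * nu a by rewrite addr_ge0.
have mur := measurable_funD (muX u) mRe.
move: key.
rewrite (@real_integralD _ _ _ Q _ mt (fun x => expR (th * (x ^+ 2 - nu a)))
  (fun x => u * nu a + v * x ^+ 2) mE mL pE pL).
rewrite (@real_integralD _ _ _ Q _ mt (fun x => u * nu a) (fun x => v * x ^+ 2)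
  (measurable_cst _) (muX v) (fun=> un0) pv).
rewrite (@real_integralD _ _ _ Q _ mt (fun x => 1 + v * nu a)
  (fun x => u * x ^+ 2 + 576 * th ^+ 2 * e x) (measurable_cst _) mur (fun=> v10) pR).
rewrite (@real_integralD _ _ _ Q _ mt (fun x => u * x ^+ 2)
  (fun x => 576 * th ^+ 2 * e x) (muX u) mRe pu e0).
clear pE pu pv pL pR.
rewrite (@real_integralZ _ _ _ Q _ mt u (fun x => x ^+ 2))//; last first.
  by move=> x; exact: sqr_ge0.
rewrite (@real_integralZ _ _ _ Q _ mt v (fun x => x ^+ 2))//; last first.
  by move=> x; exact: sqr_ge0.
rewrite (@real_integralZ _ _ _ Q _ mt (576 * th ^+ 2) e)//; last first.
  by move=> x; exact: expR_ge0.
rewrite !real_integral_cst// tail_momentE// -/(qtail a) -!EFinM -EFinD => key.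
rewrite -(@leeD2rE _ (u * nu a * qtail a + v * (nu a * qtail a))%:E)//.
apply: (le_trans key); rewrite addeA.
(* The factor 2 of the tilt bound turns 576 into 1152. *)
apply: (@le_trans _ _ (((1 + v * nu a) * qtail a)%:E + (u * (nu a * qtail a))%:E
   + (576 * th ^+ 2)%:E * (2%:E * Q (tail a)))%E).
  by rewrite leeD2l// lee_wpmul2l ?lee_fin//; exact: integral_tail_tilt.
by rewrite qtailE -!EFinM -!EFinD lee_fin; clear e0 X0 muX; lra.
Qed.

(** Off the tail the integrand is 1, so the masses q and 1 - q recombine to 1 + 1152 th^2 q. Keeping
    q in the bound is what makes p such coordinates cost only p q. *)
Lemma mgf_trunc a th : 0 <= a -> `|th| <= 1 / 8 ->
  (\int[Q]_x (expR (th * trunc a x))%:E <= (expR (1152 * th ^+ 2 * qtail a))%:E)%E.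
Proof.
move=> a0 th8; have mt := measurable_tail a.
have mE : measurable_fun setT (fun x => expR (th * trunc a x)).
  apply: (measurableT_comp (@measurable_expR R)).
  by apply: measurable_funM => //; exact: measurable_trunc.
have -> : (\int[Q]_x (expR (th * trunc a x))%:E =
    I a (fun x => expR (th * (x ^+ 2 - nu a))) + (1 - qtail a)%:E)%E.
  have mtC : measurable (~` tail a) by apply: measurableC.
  rewrite -(setUv (tail a)) ge0_integral_setU//; try first
    [ by rewrite setUv; exact/measurable_EFinP
    | by move=> x _; rewrite lee_fin expR_ge0
    | by apply/disj_set2P; rewrite setICr ].
  congr (_ + _)%E.
    by apply: eq_integral => x; rewrite inE /tail_set/= /trunc => ->.
  transitivity (\int[Q]_(x in ~` tail a) (1 : R)%:E)%E.
    apply: eq_integral => x; rewrite inE /tail_set/= /trunc => /negP/negbTE ->.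
    by rewrite mulr0 expR0.
  rewrite real_integral_cst; last exact: measurableC.
  by rewrite mul1r -[RHS]qtailC fineK// fin_num_measure.
apply: (@le_trans _ _ ((qtail a + 1152 * th ^+ 2 * qtail a)%:E + (1 - qtail a)%:E)%E).
  rewrite leeD2r//.
  (* [th] is split as u - v with one of the two parts equal to 0, according to its sign. *)
  have [t0|t0] := leP 0 th.
    by have := @tail_mgf a th 0 a0 t0 (lexx 0); rewrite subr0; apply.
  by have := @tail_mgf a 0 (- th) a0 (lexx 0); rewrite sub0r opprK; apply => //; lra.
rewrite -EFinD lee_fin; apply: le_trans (expR_ge1Dx _).
by lra.
Qed.

(** Explicit Laplace transform of a noncentral square. The noncentrality enters through th m^2 / (1
    + 2 th), which is at least th m^2 / 2 since 1 + 2 th <= 2. *)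
Lemma lower_mgf m th c : 0 <= th <= 1 / 8 ->
  (\int[normal_prob m 1]_x (expR (- th * (x ^+ 2 - c)))%:E <=
   (expR (th * (c - 1) + 2 * th ^+ 2 - th * m ^+ 2 / 2))%:E)%E.
Proof.
move=> /andP[t0 t8].
have b0 : 0 < 1 + 2 * th by lra.
have E x : expR (- th * (x ^+ 2 - c)) = expR (th * c) * expR (- th * x ^+ 2).
  by rewrite -expRD; congr expR; ring.
under eq_integral do rewrite E.
rewrite ge0_integral_realZ ?expR_ge0//; last first.
  apply: (measurableT_comp (@measurable_expR R)).
  by apply: measurable_funM => //; exact: measurable_funX.
rewrite integral_normal_expsqr// -EFinM lee_fin.
have h : (Num.sqrt (1 + 2 * th))^-1 <= expR (((2 * th) ^+ 2 - 2 * th) / 2).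
  by apply: invsqrt_le_expR; lra.
apply: (@le_trans _ _ (expR (th * c) * (expR (((2 * th) ^+ 2 - 2 * th) / 2) *
   expR (- th * m ^+ 2 / (1 + 2 * th))))).
  by rewrite ler_wpM2l ?expR_ge0// ler_wpM2r ?expR_ge0.
rewrite -!expRD ler_expR.
have : th * m ^+ 2 / 2 <= th * m ^+ 2 / (1 + 2 * th).
  have h2 : (2 : R)^-1 <= (1 + 2 * th)^-1 by rewrite lef_pV2 ?posrE//; lra.
  by apply: ler_wpM2l => //; rewrite mulr_ge0 ?sqr_ge0.
rewrite !mulNr; move: (_ / (1 + _)) => z h'.
by nra.
Qed.

End truncated_square.

(** * The CUSUM statistics *)

Section chernoff.
Context (R : realType) d (T : measurableType d) (P : probability T R).

Lemma exp_markov (V : T -> R) (x th : R) : measurable_fun setT V -> 0 <= th ->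
  (P [set w | (x <= V w)%R] <=
   (expR (- (th * x)))%:E * \int[P]_w (expR (th * V w))%:E)%E.
Proof.
move=> mV t0.
have mE : measurable [set w | x <= V w].
  rewrite -[X in measurable X]setTI (_ : [set w | _] = V @^-1` `[x, +oo[%classic).
    exact: mV.
  by apply/seteqP; split => w /=; rewrite in_itv/= andbT.
have me : measurable_fun setT (fun w => expR (th * V w)).
  by apply: (measurableT_comp (@measurable_expR R)); exact: measurable_funM.
rewrite -ge0_integral_realZ ?expR_ge0//.
rewrite -[X in P X]setIT -integral_indic//.
apply: ge0_le_integral => //.
- by apply/measurable_EFinP; exact: measurable_indic.
- by apply/measurable_EFinP; exact: measurable_funM.
move=> w _; rewrite lee_fin indicE -expRD.
case: (boolP (w \in _)) => [|_]; last exact: expR_ge0.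
rewrite inE/= => xV; rewrite -[X in X <= _]expR0 ler_expR.
by rewrite addrC subr_ge0 ler_wpM2l.
Qed.

Lemma le_prode_real (K : Type) (ks : seq K) (a : K -> \bar R) (b : K -> R) :
  (forall k, 0 <= a k)%E -> (forall k, a k <= (b k)%:E)%E ->
  (\prod_(k <- ks) a k <= (\prod_(k <- ks) b k)%:E)%E.
Proof.
move=> a0 ab; elim: ks => [|k ks IH]; first by rewrite !big_nil.
rewrite !big_cons EFinM; apply: lee_pmul => //.
by elim: ks {IH} => [|k' ks IH]; rewrite ?big_nil ?big_cons ?mule_ge0.
Qed.

End chernoff.

Section cusum_law.
Context (R : realType) d (T : measurableType d) (P : probability T R).
Context (p : nat) (Y : nat -> 'I_p -> T -> R) (sigma : R) (mu1 mu2 : 'I_p -> R).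
Context (tau : option nat).
Hypothesis sigma0 : 0 < sigma.
Hypothesis model : gauss_model P Y sigma mu1 mu2 tau.

Definition obs (ij : nat * 'I_p) : T -> R := Y ij.1.+1 ij.2.

Lemma obs_indep : mutually_independent P obs. Proof. by case: model. Qed.

Lemma obs_law ij :
  has_law P (obs ij) (normal_prob (mean_at mu1 mu2 tau ij.1.+1 ij.2) sigma).
Proof. by case: model => _ h A mA; rewrite h. Qed.

(** [i] counts from 0 and weighs observation number i + 1, in step with the shifted family [obs]
    whose independence the model provides. *)
Definition cusum_coef (t g i : nat) : R :=
  if (i < t - g)%N then Num.sqrt (g%:R / (t%:R * (t - g)%:R))
  else - Num.sqrt ((t - g)%:R / (t%:R * g%:R)).

Lemma cusum_coef_sum (t g : nat) (f : nat -> R) :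
  \sum_(0 <= i < t) cusum_coef t g i * f i.+1 =
  Num.sqrt (g%:R / (t%:R * (t - g)%:R)) * (\sum_(1 <= i < (t - g).+1) f i)
  - Num.sqrt ((t - g)%:R / (t%:R * g%:R)) * (\sum_((t - g).+1 <= i < t.+1) f i).
Proof.
rewrite (@big_cat_nat _ _ _ (t - g)%N)//= ?leq_subr//.
rewrite !big_add1 !big_distrr/= -sumrN; congr (_ + _).
  by apply: eq_big_nat => i /andP[_ ig]; rewrite /cusum_coef ig.
apply: eq_big_nat => i /andP[ig _].
by rewrite /cusum_coef ltnNge ig/= mulNr.
Qed.

(** The scalars entering the [j]-th CUSUM entry; distinct [j] give disjoint blocks, whence the
    independence of the entries. *)
Definition block (t : nat) (j : 'I_p) : seq (nat * 'I_p) :=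
  [seq (i, j) | i <- index_iota 0 t].

Lemma cusumE t g j w : cusum Y t g j w / sigma =
  \sum_(ij <- block t j) cusum_coef t g ij.1 / sigma * obs ij w.
Proof.
rewrite /cusum -(cusum_coef_sum t g (fun i => Y i j w)) big_map/= mulr_suml.
by apply: eq_bigr => i _; rewrite mulrAC.
Qed.

Context (t g : nat).
Hypotheses (g0 : (0 < g)%N) (gt : (g < t)%N).

Let gR : 0 < g%:R :> R. Proof. by rewrite ltr0n. Qed.
Let nR : 0 < (t - g)%:R :> R. Proof. by rewrite ltr0n subn_gt0. Qed.
Let tR : 0 < t%:R :> R. Proof. by rewrite ltr0n (leq_trans _ gt). Qed.
Let gnt : g%:R + (t - g)%:R = t%:R :> R.
Proof. by rewrite -natrD subnKC// ltnW. Qed.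

Lemma cusum_coef_neq0 i : cusum_coef t g i != 0.
Proof.
rewrite /cusum_coef; case: ifP => _; rewrite ?oppr_eq0 gt_eqF// sqrtr_gt0;
  by rewrite divr_gt0// mulr_gt0.
Qed.

(** The two segments contribute g/t and (t-g)/t; this normalisation gives each standardised CUSUM
    entry variance 1. *)
Lemma cusum_coef_sqr : \sum_(0 <= i < t) cusum_coef t g i ^+ 2 = 1.
Proof.
have h1 i : (0 <= i < t - g)%N ->
    cusum_coef t g i ^+ 2 = g%:R / (t%:R * (t - g)%:R).
  move=> /andP[_ ig]; rewrite /cusum_coef ig; apply: sqr_sqrtr.
  by apply: ltW; rewrite divr_gt0// mulr_gt0.
have h2 i : (t - g <= i < t)%N ->
    cusum_coef t g i ^+ 2 = (t - g)%:R / (t%:R * g%:R).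
  move=> /andP[ig _]; rewrite /cusum_coef ltnNge ig/= sqrrN; apply: sqr_sqrtr.
  by apply: ltW; rewrite divr_gt0// mulr_gt0.
rewrite (@big_cat_nat _ _ _ (t - g)%N)//= ?leq_subr//.
rewrite (eq_big_nat _ _ h1) (eq_big_nat _ _ h2).
have gt' : (g <= t)%N by exact: ltnW.
rewrite sumr_const_nat sumr_const_nat subn0 (subKn gt').
rewrite -(mulr_natr (g%:R / _)) -(mulr_natr ((t - g)%:R / _)).
move: gR nR tR gnt; move: (g%:R) ((t - g)%:R) (t%:R) => a b c a0 b0 c0 <-.
by field; rewrite !gt_eqF// addr_gt0.
Qed.

Definition cusum_mean (j : 'I_p) : R :=
  \sum_(0 <= i < t) cusum_coef t g i * mean_at mu1 mu2 tau i.+1 j / sigma.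

Lemma cusum_law j :
  has_law P (fun w => cusum Y t g j w / sigma) (normal_prob (cusum_mean j) 1).
Proof.
under eq_fun do rewrite cusumE.
have := @normal_lin _ _ _ P _ obs obs_indep (block t j)
  (fun ij => cusum_coef t g ij.1 / sigma)
  (fun ij => mean_at mu1 mu2 tau ij.1.+1 ij.2) sigma.
have -> : \sum_(ij <- block t j) cusum_coef t g ij.1 / sigma *
    mean_at mu1 mu2 tau ij.1.+1 ij.2 = cusum_mean j.
  by rewrite big_map/=; apply: eq_bigr => i _; rewrite mulrAC.
have -> : Num.sqrt (\sum_(ij <- block t j) (cusum_coef t g ij.1 / sigma) ^+ 2)
    * `|sigma| = 1.
  rewrite big_map/=; under eq_bigr do rewrite expr_div_n.
  rewrite -mulr_suml cusum_coef_sqr mul1r -exprVn sqrtr_sqr.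
  by rewrite normrV ?unitfE ?gt_eqF// mulVf// normr_eq0 gt_eqF.
apply.
- by rewrite map_inj_uniq ?iota_uniq// => x y [].
- rewrite -size_eq0 size_map size_iota subn0 -lt0n.
  by rewrite (leq_trans _ gt).
- by rewrite gt_eqF.
- by move=> ij _; rewrite mulf_neq0 ?cusum_coef_neq0// invr_eq0 gt_eqF.
- by move=> ij _; exact: obs_law.
Qed.

Lemma cusum_depends j :
  depends_on obs (block t j) (fun w => cusum Y t g j w / sigma).
Proof. by under eq_fun do rewrite cusumE; exact: depends_on_lin. Qed.

Lemma measurable_cusum j : measurable_fun setT (fun w => cusum Y t g j w / sigma).
Proof.
exact: (depends_on_measurable obs_indep (@cusum_depends j)).
Qed.

(** The Chernoff step over coordinates: the expectation of the product splits over disjoint blocks,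
    and each factor is an integral against a normal law of unit variance. *)
Lemma cusum_integral_prod (F : 'I_p -> R -> R) (b : 'I_p -> R) :
  (forall j, measurable_fun setT (F j)) -> (forall j x, 0 <= F j x) ->
  (forall j, \int[normal_prob (cusum_mean j) 1]_x (F j x)%:E <= (b j)%:E)%E ->
  (\int[P]_w (\prod_(j < p) F j (cusum Y t g j w / sigma))%:E
     <= (\prod_(j < p) b j)%:E)%E.
Proof.
move=> mF F0 Fb.
have uB : uniq (flatten [seq block t j | j <- index_enum 'I_p]).
  apply: (@allpairs_uniq _ _ _ (fun j i => (i, j))).
  - exact: index_enum_uniq.
  - exact: iota_uniq.
  - by move=> [a b'] [a' b''] _ _ /= [-> ->].
rewrite (integral_prod_blocks obs_indep uB cusum_depends mF F0).
apply: le_prode_real => j.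
  by apply: integral_ge0 => w _; rewrite lee_fin.
apply: le_trans (Fb j).
have mFj : @measurable_fun _ _ (measurableTypeR R) _ setT (fun x => (F j x)%:E).
  by apply/measurable_EFinP; exact: mF.
have Fj0 x : (0 <= (F j x)%:E)%E by rewrite lee_fin.
rewrite (@has_law_integral _ _ _ P _ (measurableTypeR R) _
  (normal_prob (cusum_mean j) 1) (fun x => (F j x)%:E)
  (@measurable_cusum j) (@cusum_law j) mFj Fj0)//.
Qed.

Lemma AstatE s w : Astat Y sigma t s g w =
  \sum_(j < p) trunc (thr p s t) (cusum Y t g j w / sigma).
Proof.
apply: eq_bigr => j _; rewrite /trunc normrM normfV (gtr0_norm sigma0).
by rewrite expr_div_n.
Qed.

Lemma measurable_Astat s : measurable_fun setT (Astat Y sigma t s g).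
Proof.
rewrite (_ : Astat _ _ _ _ _ = fun w =>
  \sum_(j < p) trunc (thr p s t) (cusum Y t g j w / sigma)); last first.
  by apply/funext => w; rewrite AstatE.
apply: measurable_sum => j.
by apply: (measurableT_comp (@measurable_trunc R _)); exact: measurable_cusum.
Qed.

Lemma thr_ge0 s : 0 <= thr p s t :> R.
Proof. by rewrite /thr; case: ifP => // _; exact: sqrtr_ge0. Qed.

Lemma measurable_exp_trunc a th : measurable_fun setT (fun x : R => expR (th * trunc a x)).
Proof.
apply: (measurableT_comp (@measurable_expR R)).
by apply: measurable_funM => //; exact: measurable_trunc.
Qed.

Lemma Astat_upper_tail s (x th : R) : (forall j, cusum_mean j = 0) ->
  0 <= th <= 1 / 8 ->
  (P [set w | (x <= Astat Y sigma t s g w)%R] <=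
   (expR (- (th * x) + 1152 * th ^+ 2 * qtail (thr p s t : R) * p%:R))%:E)%E.
Proof.
move=> m0 /andP[t0 t8].
apply: (le_trans (exp_markov P x (measurable_Astat s) t0)).
rewrite expRD EFinM lee_pmul2l ?lte_fin ?expR_gt0//.
have -> : (\int[P]_w (expR (th * Astat Y sigma t s g w))%:E = \int[P]_w
    (\prod_(j < p) expR (th * trunc (thr p s t) (cusum Y t g j w / sigma)))%:E)%E.
  by apply: eq_integral => w _; rewrite AstatE mulr_sumr expR_sum.
rewrite [X in (_ <= (expR X)%:E)%E]mulrC expRM_natl -[X in expR _ ^+ X]card_ord -prodr_const.
apply: (@cusum_integral_prod (fun _ x => expR (th * trunc (thr p s t) x))
  (fun=> expR (1152 * th ^+ 2 * qtail (thr p s t)))).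
- by move=> _; exact: measurable_exp_trunc.
- by move=> j y; exact: expR_ge0.
- by move=> j; rewrite m0; apply: mgf_trunc; rewrite ?thr_ge0// ger0_norm.
Qed.

Lemma Astat_lower_tail s (x th : R) (S : {set 'I_p}) :
  (forall j, j \notin S -> cusum_mean j = 0) -> 0 <= th <= 1 / 8 ->
  (P [set w | (Astat Y sigma t s g w <= x)%R] <=
   (expR (th * x + 1152 * th ^+ 2 * qtail (thr p s t : R) * p%:R +
     (th * (nu (thr p s t) - 1) + 2 * th ^+ 2) * #|S|%:R -
     th / 2 * \sum_(j < p) cusum_mean j ^+ 2))%:E)%E.
Proof.
move=> m0 /andP[t0 t8].
rewrite (_ : [set w | _] = [set w | - x <= - Astat Y sigma t s g w]); last first.
  by apply/seteqP; split => w /=; rewrite lerN2.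
have mN : measurable_fun setT (fun w => - Astat Y sigma t s g w).
  by apply: measurableT_comp => //; exact: measurable_Astat.
apply: (le_trans (exp_markov P (- x) mN t0)).
rewrite mulrN opprK -!addrA expRD EFinM lee_pmul2l ?lte_fin ?expR_gt0//.
have -> : (\int[P]_w (expR (th * - Astat Y sigma t s g w))%:E = \int[P]_w
    (\prod_(j < p) expR (- th * trunc (thr p s t) (cusum Y t g j w / sigma)))%:E)%E.
  by apply: eq_integral => w _; rewrite AstatE mulrN -mulNr mulr_sumr expR_sum.
pose b (j : 'I_p) := if j \in S then
  expR (th * (nu (thr p s t) - 1) + 2 * th ^+ 2 - th * cusum_mean j ^+ 2 / 2)
  else expR (1152 * th ^+ 2 * qtail (thr p s t)).
apply: (@le_trans _ _ (\prod_j b j)%:E).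
  apply: (@cusum_integral_prod (fun _ x => expR (- th * trunc (thr p s t) x)) b).
  - by move=> _; exact: measurable_exp_trunc.
  - by move=> j y; exact: expR_ge0.
  move=> j; rewrite /b; case: ifPn => jS; last first.
    rewrite m0// -sqrrN; apply: mgf_trunc; rewrite ?thr_ge0//.
    by rewrite normrN ger0_norm.
  apply: (@le_trans _ _ (\int[normal_prob (cusum_mean j) 1]_x
    (expR (- th * (x ^+ 2 - nu (thr p s t))))%:E)%E); last first.
    by apply: lower_mgf; rewrite t0.
  apply: real_integral_le => //.
  - exact: measurable_exp_trunc.
  - apply: (measurableT_comp (@measurable_expR R)).
    by apply: measurable_funM => //; apply: measurable_funB => //; exact: measurable_funX.
  - by move=> y _; rewrite ler_expR !mulNr lerN2 ler_wpM2l// trunc_ge// thr_ge0.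
rewrite lee_fin (bigID (mem S))/=.
rewrite (eq_bigr (fun j => expR (th * (nu (thr p s t) - 1) + 2 * th ^+ 2
    - th * cusum_mean j ^+ 2 / 2))); last by move=> j jS; rewrite /b jS.
rewrite [X in _ * X](eq_bigr (fun j => expR (1152 * th ^+ 2 * qtail (thr p s t))));
  last by move=> j jS; rewrite /b (negbTE jS).
have [q0 p0] : 0 <= 1152 * th ^+ 2 * qtail (thr p s t : R) /\ 0 <= th ^+ 2.
  split; last exact: sqr_ge0.
  apply: mulr_ge0; last by rewrite ltW// qtail_gt0// thr_ge0.
  by apply: mulr_ge0; [exact: ler0n|exact: sqr_ge0].
rewrite -!expR_sum -expRD ler_expR sumrB !sumr_const.
rewrite [leLHS]addrC; apply: lerD.
  (* The coordinates outside [S] are counted generously as [p]. *)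
  rewrite -(mulr_natr (1152 * th ^+ 2 * qtail _)); apply: ler_wpM2l => //.
  by rewrite ler_nat (leq_trans (max_card _))// card_ord.
rewrite -[X in X - _]mulr_natr lerD2l lerN2 mulr_sumr.
rewrite [leLHS](bigID (mem S))/= [X in _ + X]big1 ?addr0; last first.
  by move=> j jS; rewrite m0// expr0n/= mulr0.
by rewrite ler_sum// => j _; rewrite mulrAC.
Qed.

End cusum_law.

(** * The grids in terms of integer inequalities *)

Section grids.
Context (R : realType).
Implicit Types (x : R) (t g p s j : nat).

Lemma ln2_ge : 1 / 2 <= ln 2 :> R.
Proof.
rewrite -[leLHS]expRK ler_ln ?posrE ?expR_gt0//.
apply: (le_trans (expR_le_inv _)); first by lra.
by rewrite (_ : 1 - 1 / 2 = 2^-1) ?invrK//; lra.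
Qed.

Lemma ln_nat_ge t : (2 <= t)%N -> 1 / 2 <= ln t%:R :> R.
Proof.
move=> t2; apply: (le_trans ln2_ge); rewrite ler_ln ?posrE ?ltr0n//.
  by rewrite ler_nat.
by rewrite (leq_trans _ t2).
Qed.

Lemma le_floor_log2 x j : 0 < x ->
  (j%:Z <= Num.floor (log2 x))%R = (2 ^+ j <= x).
Proof.
move=> x0; rewrite floor_ge_int /log2 ler_pdivlMr; last first.
  by apply: lt_le_trans ln2_ge; lra.
rewrite -[X in _ = (X <= _)]lnK ?posrE ?exprn_gt0// -[X in _ = (_ <= X)]lnK ?posrE//.
by rewrite ler_expR lnXn// mulr_natl.
Qed.

(** Floors of logarithms become comparisons with powers of 2; starting the index at 0 absorbs the
    exponent [j - 1] in [gL] and [gR]. *)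
Lemma in_ggridP t g : (2 <= t)%N ->
  @in_ggrid R t g <-> g = 1%N \/
   (exists j : nat, (3 * 2 ^ j <= t - 1)%N /\ g = gL t j.+1) \/
   (exists j : nat, (2 ^ j.+2 <= t - 1)%N /\ g = gR t j.+1).
Proof.
move=> t2; have t1 : (0 < t - 1)%N by rewrite subn_gt0.
have tE : t%:R - 1 = (t - 1)%:R :> R by rewrite natrB// ltnW.
have t3 : 0 < (t - 1)%:R / 3 :> R by rewrite divr_gt0// ltr0n.
have hL j : (j.+1%:Z <= Num.floor (log2 ((t%:R - 1 : R) / 3)) + 1)%R =
    (3 * 2 ^ j <= t - 1)%N.
  rewrite -addn1 PoszD lerD2r tE le_floor_log2// ler_pdivlMr//.
  by rewrite -natrX -natrM ler_nat mulnC.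
have hR j : (j.+1%:Z <= Num.floor (log2 (t%:R - 1 : R)) - 1)%R =
    (2 ^ j.+2 <= t - 1)%N.
  rewrite lerBrDr -PoszD addn1 tE le_floor_log2 ?ltr0n//.
  by rewrite -natrX ler_nat.
split.
- move=> [->|[[[|j] [//]]|[[|j] [//]]]]; first by left.
    by move=> _ []; rewrite hL => ? ->; right; left; exists j.
  by move=> _ []; rewrite hR => ? ->; right; right; exists j.
- move=> [->|[[j [h ->]]|[j [h ->]]]]; first by left.
    by right; left; exists j.+1; rewrite hL.
  by right; right; exists j.+1; rewrite hR.
Qed.

Lemma gL_lt t j : (gL t j.+1 < 3 * 2 ^ j)%N.
Proof.
have h : ((t - 1) %% 2 ^ j < 2 ^ j)%N by rewrite ltn_mod expn_gt0.
have E (a b : nat) : (a < b)%N -> (2 * b + a < 3 * b)%N by lia.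
by rewrite /gL subSS subn0 expnS; exact: E.
Qed.

Lemma in_ggrid_range t g : (2 <= t)%N -> @in_ggrid R t g -> (0 < g < t)%N.
Proof.
move=> t2 /(in_ggridP _ t2)[->|[[j [h ->]]|[j [h ->]]]]; first by [].
- apply/andP; split; first by rewrite /gL addn_gt0 expn_gt0.
  by rewrite (leq_trans (gL_lt t j))// (leq_trans h) ?leq_subr.
- apply/andP; split; first by rewrite /gR /gL !addn_gt0 expn_gt0.
  rewrite /gR subSS subn0; apply: (@leq_trans (2 ^ j.+2)).
    rewrite !expnS; have := gL_lt t j; move: (gL _ _) (2 ^ j)%N => a b; lia.
  by rewrite (leq_trans h) ?leq_subr.
Qed.

(** Take the largest j with 3 2^j <= D + 1. The left point lies in [2^(j+1), 3 2^j), so it is at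
    most D, while maximality gives D + 1 < 3 2^(j+1) <= 3 g. For D = 1 there is no such j, and g = 1
    serves. *)
Lemma ggrid_scale t D : (1 <= D)%N -> (2 * D <= t)%N ->
  exists g, @in_ggrid R t g /\ (0 < g <= D)%N /\ (D <= 3 * g)%N.
Proof.
move=> D1 Dt; have t2 : (2 <= t)%N by lia.
case: (leqP D 1) => D2; first by exists 1%N; split; [left|lia].
pose P j := (3 * 2 ^ j <= D + 1)%N.
have exP : exists j, P j by exists 0%N; rewrite /P expn0; lia.
have boundP j : P j -> (j <= D)%N.
  by rewrite /P => h; have := ltn_expl j (ltnSn 1); lia.
case: (ex_maxnP exP boundP) => j Pj jmax.
have Pj1 : (D + 1 < 3 * 2 ^ j.+1)%N.
  by rewrite ltnNge; apply/negP => /jmax; rewrite ltnn.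
exists (gL t j.+1); split; first by apply/in_ggridP => //; right; left; exists j; split=> //; rewrite /P in Pj; lia.
have h1 := gL_lt t j; have h2 : (2 ^ j.+1 <= gL t j.+1)%N by rewrite /gL leq_addr.
have h3 : (0 < 2 ^ j.+1)%N by rewrite expn_gt0.
by rewrite /P in Pj; move: (gL _ _) h1 h2 => a; lia.
Qed.

Lemma in_sgridP p t s : (0 < p)%N -> (2 <= t)%N ->
  @in_sgrid R p t s <-> s = p \/ exists j : nat,
    [/\ ((2 ^ j)%:R : R) <= Num.sqrt (p%:R * ln t%:R), (2 ^ j <= p)%N & s = (2 ^ j)%N].
Proof.
move=> p0 t2; have l0 : 0 < ln t%:R :> R by apply: lt_le_trans (ln_nat_ge t2); lra.
have m0 : 0 < Num.min (Num.sqrt (p%:R * ln t%:R)) p%:R :> R.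
  by rewrite lt_min ltr0n p0 sqrtr_gt0 mulr_gt0// ltr0n.
split => -[->|[j]]; try by left.
  by rewrite le_floor_log2// le_min -natrX ler_nat => -[/andP[? ?] ->]; right; exists j.
by move=> [h1 h2 ->]; right; exists j; rewrite le_floor_log2// le_min -natrX ler_nat h1 h2.
Qed.

Lemma zfun_gt0 p t s : (0 < p)%N -> (2 <= t)%N -> 0 < zfun s p t :> R.
Proof.
move=> p0 t2; have l0 : 0 < ln t%:R :> R by apply: lt_le_trans (ln_nat_ge t2); lra.
rewrite /zfun; case: ifP => _; first by rewrite sqrtr_gt0 mulr_gt0// ltr0n.
by rewrite lt_max l0 orbT.
Qed.

End grids.

(** * Choice of the Chernoff exponent under the null *)

Section exponents.
Context (R : realType).

(** The last admissible power dominates: all smaller powers together do not exceed it. Here 4^j is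
    s^2 for s = 2^j. *)
Lemma sum_pow4_le (X : R) n : 0 <= X ->
  \sum_(0 <= j < n | 4 ^+ j <= X) 4 ^+ j <= 2 * X.
Proof.
move=> X0.
have h k : \sum_(0 <= j < k) 4 ^+ j <= 4 ^+ k :> R.
  elim: k => [|k IH]; first by rewrite big_nil expr0.
  rewrite big_nat_recr//= exprS; have : 0 <= 4 ^+ k :> R by rewrite exprn_ge0.
  by lra.
elim: n => [|n IH]; first by rewrite big_nil mulr_ge0.
rewrite big_mkcond big_nat_recr//= -big_mkcond/=.
case: ifPn => nX; last by rewrite addr0.
apply: (@le_trans _ _ (4 ^+ n + 4 ^+ n)); last by lra.
rewrite lerD2r; apply: le_trans (h n); rewrite big_mkcond/=.
by apply: ler_sum => j _; case: ifP => // _; rewrite exprn_ge0.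
Qed.

(** Lets [delta^-1] stand for log (1/delta) in both constants of the theorem. *)
Lemma expR_Ninv_le (delta : R) : 0 < delta -> expR (- delta^-1) <= delta.
Proof.
move=> d0; have v0 : 0 < delta^-1 by rewrite invr_gt0.
have dV : - delta^-1 < 1 by lra.
apply: (le_trans (expR_le_inv dV)); rewrite opprK.
by rewrite -[leRHS]invrK lef_pV2 ?posrE; lra.
Qed.

Lemma expR1_ge2 : 2 <= expR 1 :> R.
Proof. by have := expR_ge1Dx (1 : R); lra. Qed.

(** p q is the expected number of pure noise coordinates above the threshold; the constant is 3/(2e)
    <= 1. *)
Lemma sparse_pq (p s L q : R) : 0 < p -> 0 < s -> 0 < L ->
  q <= 3 / 2 / (expR 1 * p * L / s ^+ 2) -> p * q <= s ^+ 2 / L.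
Proof.
move=> p0 s0 L0 hq; have e2 := expR1_ge2; have e0 : 0 < expR 1 :> R by exact: expR_gt0.
apply: (@le_trans _ _ (p * (3 / 2 / (expR 1 * p * L / s ^+ 2)))).
  by rewrite ler_wpM2l// ltW.
have -> : p * (3 / 2 / (expR 1 * p * L / s ^+ 2)) = s ^+ 2 / L * (3 / 2 / expR 1).
  by field; rewrite !gt_eqF.
apply: ler_piMr; first by rewrite divr_ge0 ?sqr_ge0// ltW.
by rewrite ler_pdivrMr//; lra.
Qed.

Lemma sparse_ln_ge1 (p s L : R) : 0 < s -> s ^+ 2 <= p * L ->
  1 <= ln (expR 1 * p * L / s ^+ 2).
Proof.
move=> s0 spL; have s20 : 0 < s ^+ 2 by rewrite exprn_gt0.
rewrite -[leLHS]expRK ler_ln ?posrE ?expR_gt0//; last first.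
  by rewrite divr_gt0// -mulrA mulr_gt0 ?expR_gt0// (lt_le_trans s20).
by rewrite -!mulrA ler_peMr ?expR_ge0// mulrA ler_pdivlMr// mul1r.
Qed.

(* The exponent is taken as [min 1 (L / s) / 8]: the second bound makes the
   variance term [1152 * th ^+ 2 * q * p] at most half of the linear term. *)
Lemma sparse_exponent (p s L q z lam : R) : 0 < p -> 1 <= s -> 1 / 2 <= L ->
  s ^+ 2 <= p * L -> q <= 3 / 2 / (expR 1 * p * L / s ^+ 2) ->
  s * ln (expR 1 * p * L / s ^+ 2) <= z -> L <= z -> 288 <= lam ->
  exists2 th : R, 0 <= th <= 1 / 8 &
    - (th * (lam * z)) + 1152 * th ^+ 2 * q * p <=
    - (lam / 32 * (L + ln (expR 1 * p * L / s ^+ 2) / 2)).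
Proof.
move=> p0 s1 L12 spL hq zl zL lam0.
have s0 : 0 < s by lra. have L0 : 0 < L by lra.
have l1 := sparse_ln_ge1 s0 spL.
have pq := sparse_pq p0 s0 L0 hq.
set l := ln _ in zl l1 *.
(* The first condition on [th] bounds the variance term by 144 th z, half of the linear term as lam
   >= 288. The second turns the remaining lam th z / 2 into the announced exponent. *)
have key th : 0 <= th <= 1 / 8 -> th * s <= L / 8 -> L + l / 2 <= 16 * (th * z) ->
    - (th * (lam * z)) + 1152 * th ^+ 2 * q * p <= - (lam / 32 * (L + l / 2)).
  move=> /andP[t0 t8] ths thz.
  have z0 : 0 <= z by lra.
  have h1 : 1152 * th ^+ 2 * q * p <= 144 * (th * z).
    have -> : 1152 * th ^+ 2 * q * p = 1152 * th ^+ 2 * (p * q) by ring.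
    apply: (@le_trans _ _ (1152 * th ^+ 2 * (s ^+ 2 / L))).
      apply: ler_wpM2l; last exact: pq.
      by apply: mulr_ge0; [exact: ler0n|exact: sqr_ge0].
    have -> : 1152 * th ^+ 2 * (s ^+ 2 / L) = 1152 * (th * s) * (th * s / L).
      by field; rewrite gt_eqF.
    have h3 : th * s / L <= 1 / 8 by rewrite ler_pdivrMr//; lra.
    have ts0 : 0 <= th * s by rewrite mulr_ge0// ltW.
    apply: (@le_trans _ _ (1152 * (th * s) * (1 / 8))).
      apply: ler_wpM2l; last exact: h3.
      by apply: mulr_ge0; [exact: ler0n|exact: ts0].
    have : th * s <= th * z.
      by apply: ler_wpM2l => //; apply: le_trans zl; rewrite ler_peMr// ltW.
    by lra.
  have tz0 : 0 <= th * z by rewrite mulr_ge0.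
  have h2 : 288 * (th * z) <= lam * (th * z) by rewrite ler_wpM2r.
  have h4 : lam * (L + l / 2) <= lam * (16 * (th * z)) by rewrite ler_wpM2l//; lra.
  rewrite (_ : th * (lam * z) = lam * (th * z)); last by ring.
  by lra.
have [sL|Ls] := leP s L.
  exists (1 / 8); first by lra.
  apply: key; [by lra|by lra|].
  have : l <= z by apply: le_trans zl; rewrite ler_peMl//; lra.
  by lra.
exists (L / s / 8).
  have h : L / s <= 1 by rewrite ler_pdivrMr//; lra.
  have : 0 <= L / s by rewrite divr_ge0// ltW.
  by lra.
apply: key.
- have h : L / s <= 1 by rewrite ler_pdivrMr//; lra.
  have : 0 <= L / s by rewrite divr_ge0// ltW.
  by lra.
- by rewrite (_ : L / s / 8 * s = L / 8)//; field; rewrite gt_eqF.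
have h : L * l <= L / s * z.
  have -> : L * l = L / s * (s * l) by field; rewrite gt_eqF.
  by rewrite ler_wpM2l// divr_ge0// ltW.
have h1 : L <= L * l by rewrite ler_peMr// ltW.
have h2 : 1 / 2 * l <= L * l by rewrite ler_wpM2r//; lra.
have -> : 16 * (L / s / 8 * z) = 2 * (L / s * z) by field; rewrite gt_eqF.
by lra.
Qed.

(** With S = sqrt (p L) and th = L/(8 S), one has th S = L/8 and th^2 p = L/64, so both terms are of
    order L; L <= p gives L <= S and hence th <= 1/8. *)
Lemma dense_exponent (p L q lam : R) : 0 < p -> 1 / 2 <= L -> L <= p -> q <= 1 ->
  288 <= lam -> exists2 th : R, 0 <= th <= 1 / 8 &
    - (th * (lam * Num.sqrt (p * L))) + 1152 * th ^+ 2 * q * p <= - (lam / 32 * L).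
Proof.
move=> p0 L12 Lp q1 lam0; have L0 : 0 < L by lra.
set S := Num.sqrt (p * L).
have pL0 : 0 < p * L by rewrite mulr_gt0.
have S0 : 0 < S by rewrite sqrtr_gt0.
have SS : S ^+ 2 = p * L by rewrite sqr_sqrtr// ltW.
have LS : L <= S.
  have : Num.sqrt (L ^+ 2) <= S by rewrite /S ler_wsqrtr// expr2 ler_wpM2r// ltW.
  by rewrite sqrtr_sqr ger0_norm// ltW.
exists (L / S / 8).
  have h : L / S <= 1 by rewrite ler_pdivrMr//; lra.
  have : 0 <= L / S by rewrite divr_ge0// ltW.
  by lra.
have -> : L / S / 8 * (lam * S) = lam * L / 8 by field; rewrite gt_eqF.
have -> : 1152 * (L / S / 8) ^+ 2 * q * p = 18 * (L ^+ 2 / S ^+ 2 * p) * q.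
  by field; rewrite gt_eqF.
rewrite SS (_ : L ^+ 2 / (p * L) * p = L); last by field; rewrite !gt_eqF.
have h : 18 * L * q <= 18 * L * 1 by apply: ler_wpM2l => //; lra.
have h' : 288 * L <= lam * L by rewrite ler_wpM2r// ltW.
by lra.
Qed.

End exponents.

(** * False alarms *)

Section union_bound.
Context (R : realType) d (T : measurableType d) (P : probability T R).

Lemma union_bound (E : nat -> set T) (b : nat -> R) (c : R) :
  (forall i, measurable (E i)) -> (forall i, P (E i) <= (b i)%:E)%E ->
  (forall n, \sum_(0 <= i < n) b i <= c) -> (P (\bigcup_i E i) <= c%:E)%E.
Proof.
move=> mE Eb bc.
apply: (le_trans (generalized_Boole_inequality P mE _)).
  exact: bigcupT_measurable.
apply: lime_le; first by apply: is_cvg_nneseries.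
apply: nearW => n; apply: (@le_trans _ _ (\sum_(0 <= i < n) b i)%:E).
  by rewrite -sumEFin; apply: lee_sum => i _; exact: Eb.
by rewrite lee_fin.
Qed.

End union_bound.

Section stopping_events.
Context (R : realType) d (T : measurableType d) (p : nat).
Context (Y : nat -> 'I_p -> T -> R) (sigma lam : R).

Definition alarm (t : nat) : set T :=
  [set w | (2 <= t)%N /\ exists g, @in_ggrid R t g /\ Ttest Y sigma lam t g w].

Lemma tau_hat_lty : [set w | (tau_hat Y sigma lam w < +oo)%E] = \bigcup_t alarm t.
Proof.
apply/seteqP; split => w /=.
  by move=> /ereal_inf_lt[_ [t [t2 ht] <-] _]; exists t.
move=> [t _ [t2 ht]]; apply: (@le_lt_trans _ _ (t%:R : R)%:E); last exact: ltry.
by apply: ereal_inf_lbound; exists t.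
Qed.

Lemma tau_hat_le_alarm (n m : nat) w : (n <= m)%N -> alarm n w ->
  (tau_hat Y sigma lam w <= (m%:R : R)%:E)%E.
Proof.
move=> nm [n2 h]; apply: (@le_trans _ _ (n%:R : R)%:E).
  by apply: ereal_inf_lbound; exists n.
by rewrite lee_fin ler_nat.
Qed.

Lemma tau_hat_le (m : nat) :
  [set w | (tau_hat Y sigma lam w <= (m%:R : R)%:E)%E] =
  \bigcup_t (if (t <= m)%N then alarm t else set0).
Proof.
apply/seteqP; split => w /=; last first.
  by move=> [t _]; case: ifP => // tm; exact: tau_hat_le_alarm.
(* Alarm times are integers: [m] is replaced by [m.+1] because a strict bound on the infimum yields
   an actual alarm time. *)
move=> h; have /ereal_inf_lt[_ [t [t2 ht] <-]] : (tau_hat Y sigma lam w < (m.+1%:R : R)%:E)%E.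
  by apply: (le_lt_trans h); rewrite lte_fin ltr_nat.
rewrite lte_fin ltr_nat ltnS => tm; exists t => //.
by rewrite tm; split.
Qed.

Definition hit (t s g : nat) : set T :=
  [set w | 1 < Astat Y sigma t s g w / (lam * zfun s p t)].

(** Indices outside the grids contribute [set0], so the alarm event is a countable union over all
    naturals and measurability is immediate. *)
Lemma alarmE t : alarm t = \bigcup_g \bigcup_s
  (if `[< (2 <= t)%N /\ @in_ggrid R t g /\ @in_sgrid R p t s >]
   then hit t s g else set0).
Proof.
apply/seteqP; split => w.
  move=> [t2 [g [gG [s [sS h]]]]]; exists g => //; exists s => //.
  by case: asboolP => // no; exfalso; apply: no.
move=> [g _ [s _]]; case: asboolP => // -[t2 [gG sS]] h.
by split => //; exists g; split => //; exists s.
Qed.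

Context (P : probability T R) (mu1 mu2 : 'I_p -> R) (tau : option nat).
Hypothesis sigma0 : 0 < sigma.
Hypothesis model : gauss_model P Y sigma mu1 mu2 tau.

Lemma measurable_hit t s g : measurable (hit t s g).
Proof.
have mA := measurable_Astat sigma0 model t g s.
have mf : measurable_fun setT (fun w => Astat Y sigma t s g w / (lam * zfun s p t)).
  exact: measurable_funM.
rewrite -[X in measurable X]setTI (_ : hit t s g =
  (fun w => Astat Y sigma t s g w / (lam * zfun s p t)) @^-1` `]1, +oo[%classic).
  exact: mf.
by apply/seteqP; split => w /=; rewrite in_itv/= andbT.
Qed.

Lemma measurable_alarm t : measurable (alarm t).
Proof.
rewrite alarmE; apply: bigcupT_measurable => g; apply: bigcupT_measurable => s.
by case: ifP => // _; exact: measurable_hit.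
Qed.

Lemma measurable_tau_hat_le (m : nat) :
  measurable [set w | (tau_hat Y sigma lam w <= (m%:R : R)%:E)%E].
Proof.
rewrite tau_hat_le; apply: bigcupT_measurable => t.
by case: ifP => // _; exact: measurable_alarm.
Qed.

End stopping_events.

Section false_alarm.
Context (R : realType).

(** The logarithm is at least 1 in this regime, so the square root in [thr] is not cut off at 0 and
    its square is the intended value. *)
Lemma thr_sparse (p s t : nat) : (0 < p)%N -> (0 < s)%N -> (2 <= t)%N ->
  s%:R <= Num.sqrt (p%:R * ln t%:R) :> R ->
  [/\ s%:R ^+ 2 <= p%:R * ln t%:R :> R,
      thr p s t ^+ 2 = 4 * ln (expR 1 * p%:R * ln t%:R / s%:R ^+ 2) :> R &
      zfun s p t = Num.max (s%:R * ln (expR 1 * p%:R * ln t%:R / s%:R ^+ 2)) (ln t%:R) :> R].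
Proof.
move=> p0 s0 t2 sS.
have L0 : 0 < ln t%:R :> R by apply: lt_le_trans (ln_nat_ge R t2); lra.
have pL0 : 0 <= p%:R * ln t%:R :> R by rewrite mulr_ge0// ltW.
have spL : s%:R ^+ 2 <= p%:R * ln t%:R :> R.
  by rewrite -[leRHS]sqr_sqrtr// lerXn2r// nnegrE// sqrtr_ge0.
split => //; last by rewrite /zfun ltNge sS.
have s0R : 0 < s%:R :> R by rewrite ltr0n.
have xE : expR 1 * p%:R / s%:R ^+ 2 * ln t%:R =
    expR 1 * p%:R * ln t%:R / s%:R ^+ 2 :> R by rewrite mulrAC.
rewrite /thr sS xE sqr_sqrtr// mulr_ge0//.
by apply: le_trans (sparse_ln_ge1 s0R spL).
Qed.

Lemma qtail_sparse (p s t : nat) : (0 < p)%N -> (0 < s)%N -> (2 <= t)%N ->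
  s%:R <= Num.sqrt (p%:R * ln t%:R) :> R ->
  qtail (thr p s t) <= 3 / 2 / (expR 1 * p%:R * ln t%:R / s%:R ^+ 2) :> R.
Proof.
move=> p0 s0 t2 sS; have [spL aE _] := thr_sparse p0 s0 t2 sS.
have L0 : 0 < ln t%:R :> R by apply: lt_le_trans (ln_nat_ge R t2); lra.
have x0 : 0 < expR 1 * p%:R * ln t%:R / s%:R ^+ 2 :> R.
  by rewrite divr_gt0 ?exprn_gt0 ?ltr0n// !mulr_gt0 ?expR_gt0 ?ltr0n.
apply: (le_trans (qtail_le (thr_ge0 R p t s))); rewrite aE.
by rewrite (_ : 4 * _ / 4 = ln (expR 1 * p%:R * ln t%:R / s%:R ^+ 2));
  [rewrite expRN lnK ?posrE|field].
Qed.

Lemma thr_dense (p s t : nat) : Num.sqrt (p%:R * ln t%:R) < s%:R :> R ->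
  thr p s t = 0 :> R /\ zfun s p t = Num.sqrt (p%:R * ln t%:R) :> R.
Proof. by move=> sS; rewrite /thr /zfun leNgt sS. Qed.

Context d (T : measurableType d) (P : probability T R) (p : nat).
Context (Y : nat -> 'I_p -> T -> R) (sigma lam : R) (mu1 mu2 : 'I_p -> R).
Hypotheses (p0 : (0 < p)%N) (sigma0 : 0 < sigma) (lam288 : 288 <= lam).
Hypothesis model : gauss_model P Y sigma mu1 mu2 None.

Let pR : 0 < p%:R :> R. Proof. by rewrite ltr0n. Qed.
Let lam0 : 0 < lam. Proof. by move: lam288; lra. Qed.

(** The two weights balance on constants: each segment receives total weight sqrt (g (t-g) / t). *)
Lemma cusum_mean_null t g j : (0 < g < t)%N -> cusum_mean sigma mu1 mu2 None t g j = 0.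
Proof.
move=> /andP[g0 gt]; rewrite /cusum_mean -mulr_suml.
rewrite (cusum_coef_sum t g (fun=> mu1 j)) !sumr_const_nat.
rewrite subn1/= subSS (subKn (ltnW gt)).
set n := (t - g)%N.
have n0 : 0 < n%:R :> R by rewrite ltr0n subn_gt0.
have gR : 0 < g%:R :> R by rewrite ltr0n.
have tR : 0 < t%:R :> R by rewrite ltr0n (leq_trans _ gt).
suff -> : Num.sqrt (g%:R / (t%:R * n%:R)) * (mu1 j *+ n) =
    Num.sqrt (n%:R / (t%:R * g%:R)) * (mu1 j *+ g) by rewrite subrr mul0r.
rewrite -(mulr_natr (mu1 j) n) -(mulr_natr (mu1 j) g) ![mu1 j * _]mulrC !mulrA.
congr (_ * _).
have E (x y : R) : 0 <= y -> Num.sqrt x * y = Num.sqrt (y ^+ 2 * x).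
  by move=> y0; rewrite sqrtrM ?sqr_ge0// sqrtr_sqr ger0_norm// mulrC.
rewrite !E ?ler0n//; congr Num.sqrt.
by field; rewrite !gt_eqF.
Qed.

Lemma hit_tail t s g th : (2 <= t)%N -> (0 < g < t)%N -> 0 <= th <= 1 / 8 ->
  (P (hit Y sigma lam t s g) <=
   (expR (- (th * (lam * zfun s p t)) + 1152 * th ^+ 2 * qtail (thr p s t : R) * p%:R))%:E)%E.
Proof.
move=> t2 gt th8; have /andP[g0 gt'] := gt.
have z0 : 0 < lam * zfun s p t by apply: mulr_gt0 => //; exact: zfun_gt0.
apply: le_trans (@Astat_upper_tail _ _ _ P p Y sigma mu1 mu2 None sigma0 model
  t g g0 gt' s (lam * zfun s p t) th _ th8); last first.
  by move=> j; exact: cusum_mean_null.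
apply: le_measure; rewrite ?inE.
- exact: (measurable_hit lam sigma0 model t s g).
- have mA := measurable_Astat sigma0 model t g s.
  rewrite -[X in measurable X]setTI (_ : [set w | _] =
    Astat Y sigma t s g @^-1` `[lam * zfun s p t, +oo[%classic).
    exact: mA.
  by apply/seteqP; split => w /=; rewrite in_itv/= andbT.
- by move=> w; rewrite /hit/= ltr_pdivlMr// mul1r => /ltW.
Qed.

Lemma hit_sparse t s g : (2 <= t)%N -> (0 < g < t)%N -> (0 < s)%N ->
  s%:R <= Num.sqrt (p%:R * ln t%:R) :> R ->
  (P (hit Y sigma lam t s g) <=
   (expR (- (lam / 32 * (ln t%:R + ln (expR 1 * p%:R * ln t%:R / s%:R ^+ 2) / 2))))%:E)%E.
Proof.
move=> t2 gt s0 sS; have [spL aE zE] := thr_sparse p0 s0 t2 sS.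
have s1 : 1 <= s%:R :> R by rewrite (ler_nat _ 1).
have [||th th8 h] := sparse_exponent (z := zfun s p t) pR s1 (ln_nat_ge R t2) spL
  (qtail_sparse p0 s0 t2 sS) _ _ lam288.
- by rewrite zE le_max lexx.
- by rewrite zE le_max lexx orbT.
by apply: (le_trans (hit_tail s t2 gt th8)); rewrite lee_fin ler_expR.
Qed.

(** s = p belongs to the grid in either regime. If p > sqrt (p log t), then log t < p, as
    [dense_exponent] requires. *)
Lemma hit_top t g : (2 <= t)%N -> (0 < g < t)%N ->
  (P (hit Y sigma lam t p g) <= (expR (- (lam / 32 * ln t%:R)))%:E)%E.
Proof.
move=> t2 gt; have L12 := ln_nat_ge R t2.
have [pS|Sp] := leP (p%:R : R) (Num.sqrt (p%:R * ln t%:R)).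
  apply: (le_trans (hit_sparse t2 gt p0 pS)); rewrite lee_fin ler_expR lerN2.
  have [spL _ _] := thr_sparse p0 p0 t2 pS.
  have := sparse_ln_ge1 pR spL; set l := ln (_ / _) => l1.
  have h1 : 0 <= lam / 32 by rewrite divr_ge0// ltW.
  have h2 : ln t%:R <= ln t%:R + l / 2 by lra.
  exact: ler_wpM2l.
have [a0 zE] := thr_dense Sp.
have Lp : ln t%:R <= p%:R :> R.
  have pL0 : 0 <= p%:R * ln t%:R :> R by rewrite mulr_ge0//; lra.
  have : Num.sqrt (p%:R * ln t%:R) ^+ 2 < p%:R ^+ 2 :> R.
    by rewrite ltrXn2r// ?nnegrE ?sqrtr_ge0.
  by rewrite sqr_sqrtr// expr2 ltr_pM2l// => /ltW.
have [th th8 h] := dense_exponent pR L12 Lp (qtail_le1 (thr p p t)) lam288.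
by apply: (le_trans (hit_tail p t2 gt th8)); rewrite lee_fin ler_expR zE.
Qed.

Lemma alarm_grid_tail t g : (2 <= t)%N -> (0 < g < t)%N ->
  (P (\bigcup_s (if `[< @in_sgrid R p t s >] then hit Y sigma lam t s g else set0)) <=
   (2 * expR (- (lam / 32 * ln t%:R)))%:E)%E.
Proof.
move=> t2 gt; have mH s := measurable_hit lam sigma0 model t s g.
set L := ln t%:R : R; have L12 : 1 / 2 <= L := ln_nat_ge R t2.
pose X : R := p%:R * L; have X0 : 0 < X by rewrite mulr_gt0//; lra.
pose E j := if (2 ^+ j <= Num.sqrt X) then hit Y sigma lam t (2 ^ j)%N g else set0.
(* 4^j/(e X) is exp(-l) for the logarithm l at s = 2^j; the exponent contains lam l / 64 >= l. As
   the admissible 4^j sum to at most 2 X and e >= 2, all these s together cost no more than s = p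
   alone. *)
pose b j := if (4 ^+ j <= X) then expR (- (lam / 32 * L)) * (4 ^+ j / (expR 1 * X)) else 0.
have mE j : measurable (E j) by rewrite /E; case: ifP.
have sub : \bigcup_s (if `[< @in_sgrid R p t s >] then hit Y sigma lam t s g else set0)
    `<=` hit Y sigma lam t p g `|` \bigcup_j E j.
  move=> w [s _]; case: asboolP => // /(in_sgridP R s p0 t2)[->|[j [h1 _ ->]]] h; first by left.
  by right; exists j => //; rewrite /E /X natrX in h1 *; rewrite h1.
have mU : measurable (\bigcup_j E j) by exact: bigcupT_measurable.
apply: (@le_trans _ _ (P (hit Y sigma lam t p g `|` \bigcup_j E j))).
  apply: le_measure => //; rewrite inE.
    by apply: bigcupT_measurable => s; case: ifP.
  exact: measurableU.
apply: (le_trans (measureU2 _ _ _)) => //.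
rewrite [X in (_ <= X)%E](_ : _ = (expR (- (lam / 32 * L)))%:E + (expR (- (lam / 32 * L)))%:E)%E; last first.
  by rewrite -EFinD; congr EFin; ring.
apply: leeD; first exact: hit_top.
have sq4 j : (2 ^+ j <= Num.sqrt X) = (4 ^+ j <= X).
  have -> : 4 ^+ j = (2 ^+ j) ^+ 2 :> R by rewrite -exprM mulnC exprM; congr (_ ^+ _); lra.
  rewrite -{2}(sqr_sqrtr (ltW X0)); apply/esym; apply: ler_pXn2r => //.
    by rewrite nnegrE exprn_ge0.
  by rewrite nnegrE sqrtr_ge0.
apply: (union_bound (b := b)) => //.
  move=> j; rewrite /E /b -sq4; case: ifPn => h; last by rewrite measure0.
  have s0 : (0 < 2 ^ j)%N by rewrite expn_gt0.
  have h' : (2 ^ j)%:R <= Num.sqrt (p%:R * ln t%:R) :> R by rewrite natrX.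
  apply: (le_trans (hit_sparse t2 gt s0 h')); rewrite lee_fin.
  have [spL _ _] := thr_sparse p0 s0 t2 h'.
  have s0R : 0 < (2 ^ j)%:R :> R by rewrite ltr0n.
  have := sparse_ln_ge1 s0R spL.
  have x0 : 0 < expR 1 * p%:R * ln t%:R / (2 ^ j)%:R ^+ 2 :> R.
    by rewrite divr_gt0 ?exprn_gt0// -mulrA mulr_gt0 ?expR_gt0.
  rewrite (_ : 4 ^+ j / (expR 1 * X) = (expR 1 * p%:R * ln t%:R / (2 ^ j)%:R ^+ 2)^-1); last first.
    rewrite invf_div natrX -exprM mulnC exprM /X mulrA; congr (_ ^+ _ / _); lra.
  rewrite -[X in _ -> _ <= _ * X^-1]lnK ?posrE// -expRN -expRD ler_expR.
  set l := ln (_ / _) => l1.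
  have : 64 * l <= lam * l.
    by apply: ler_wpM2r; [lra|move: lam288; lra].
  by rewrite -/L; lra.
move=> n.
have -> : \sum_(0 <= i < n) b i = expR (- (lam / 32 * L)) / (expR 1 * X) *
    \sum_(0 <= j < n | 4 ^+ j <= X) 4 ^+ j.
  rewrite mulr_sumr [RHS]big_mkcond/=; apply: eq_bigr => j _.
  by rewrite /b; case: ifP => // _; rewrite mulrA mulrAC.
have eX : 0 < expR 1 * X by rewrite mulr_gt0 ?expR_gt0.
apply: (@le_trans _ _ (expR (- (lam / 32 * L)) / (expR 1 * X) * (2 * X))).
  apply: ler_wpM2l; first by rewrite divr_ge0 ?expR_ge0// ltW.
  by apply: sum_pow4_le; exact: ltW.
rewrite -mulrA; apply: ler_piMr; first exact: expR_ge0.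
rewrite mulrC ler_pdivrMr// mul1r; apply: ler_wpM2r; first exact: ltW.
exact: expR1_ge2.
Qed.

Lemma alarm_tail t : (2 <= t)%N ->
  (P (alarm Y sigma lam t) <= (2 * t%:R * expR (- (lam / 32 * ln t%:R)))%:E)%E.
Proof.
move=> t2; set e := expR _.
pose E g := if (0 < g < t)%N then
  \bigcup_s (if `[< @in_sgrid R p t s >] then hit Y sigma lam t s g else set0) else set0.
have mE g : measurable (E g).
  rewrite /E; case: ifP => // gt; apply: bigcupT_measurable => s.
  by case: ifP => // _; exact: measurable_hit sigma0 model _ _ _.
have sub : alarm Y sigma lam t `<=` \bigcup_g E g.
  move=> w [_ [g [gG [s [sS h]]]]]; exists g => //; rewrite /E (in_ggrid_range t2 gG).
  by exists s => //; case: asboolP.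
apply: (@le_trans _ _ (P (\bigcup_g E g))).
  apply: le_measure => //; rewrite inE; first exact: measurable_alarm sigma0 model _.
  exact: bigcupT_measurable.
apply: (union_bound (b := fun g => if (0 < g < t)%N then 2 * e else 0)) => //.
  move=> g; rewrite /E; case: ifPn => gt; last by rewrite measure0.
  exact: alarm_grid_tail.
have e0 : 0 <= 2 * e by rewrite mulr_ge0// expR_ge0.
(* At most min(k, t) indices below [k] pass the filter; the bound must hold for every partial
   sum. *)
have h k : \sum_(0 <= g < k) (if (0 < g < t)%N then 2 * e else 0) <= (minn k t)%:R * (2 * e).
  elim: k => [|k IH]; first by rewrite big_nil min0n mul0r.
  rewrite big_nat_recr//=; case: ifPn => kt.
    have -> : (minn k.+1 t = (minn k t).+1)%N by lia.
    have -> : (minn k t).+1%:R * (2 * e) = (minn k t)%:R * (2 * e) + 2 * e.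
      by rewrite -[(minn k t).+1%:R]natr1; ring.
    by rewrite lerD2r; exact: IH.
  rewrite addr0; apply: (le_trans IH); rewrite ler_wpM2r// ler_nat; lia.
move=> n; apply: (le_trans (h n)).
rewrite [leRHS](_ : _ = t%:R * (2 * e)); last by ring.
by rewrite ler_wpM2r// ler_nat geq_minr.
Qed.

Lemma false_alarm_bound delta : 0 < delta < 1 -> 32 * (4 + 2 / delta) <= lam ->
  (P [set w | (tau_hat Y sigma lam w < +oo)%E] <= delta%:E)%E.
Proof.
move=> /andP[d0 d1] lamd; rewrite tau_hat_lty.
pose b t := if (2 <= t)%N then 2 * t%:R * expR (- (lam / 32 * ln t%:R)) else 0.
apply: (union_bound (b := b)).
- by move=> t; exact: measurable_alarm sigma0 model _.
- move=> t; rewrite /b; case: ifPn => t2; first exact: alarm_tail.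
  rewrite (_ : alarm _ _ _ _ = set0) ?measure0//.
  by apply/seteqP; split => // w []; rewrite (negbTE t2).
(* At time t the bound is 2 t delta / t^4 = 2 delta / t^3, which is below delta (1/(t-1) - 1/t), a
   telescoping series. *)
have bt t : b t.+2 <= delta * (t.+1%:R^-1 - t.+2%:R^-1).
  rewrite /b /=; set L := ln _ : R.
  have L12 : 1 / 2 <= L := ln_nat_ge R (isT : (2 <= t.+2)%N).
  have tp : 0 < t.+2%:R :> R by rewrite ltr0n.
  have e1 : expR (- (lam / 32 * L)) <= delta / t.+2%:R ^+ 4.
    (* The 4 in the bound on [lam] gives t^-4. The 2/delta gives exp(-1/delta) <= delta, since log t
       >= 1/2. *)
    apply: (@le_trans _ _ (expR (- (4%:R * L)) * expR (- (2 / delta * L)))).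
      rewrite -expRD ler_expR -opprD lerN2 -mulrDl ler_wpM2r//; first by lra.
      by rewrite ler_pdivlMr//; lra.
    have -> : expR (- (4%:R * L)) = (t.+2%:R ^+ 4)^-1.
      by rewrite expRN expRM_natl lnK ?posrE.
    rewrite mulrC; apply: ler_wpM2r; first by rewrite invr_ge0 exprn_ge0.
    apply: (@le_trans _ _ (expR (- delta^-1))).
      rewrite ler_expR lerN2 (_ : 2 / delta * L = 2 * L * delta^-1); last by ring.
      by apply: ler_peMl; [rewrite invr_ge0 ltW|lra].
    exact: expR_Ninv_le.
  apply: (@le_trans _ _ (2 * t.+2%:R * (delta / t.+2%:R ^+ 4))).
    by rewrite ler_wpM2l// mulr_ge0// ltW.
  have -> : 2 * t.+2%:R * (delta / t.+2%:R ^+ 4) = delta * (2 / t.+2%:R ^+ 3).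
    by field; rewrite gt_eqF.
  rewrite ler_pM2l//.
  have t1 : 0 < t.+1%:R :> R by rewrite ltr0n.
  have E : t.+2%:R = t.+1%:R + 1 :> R by rewrite natr1.
  have -> : t.+1%:R^-1 - t.+2%:R^-1 = (t.+1%:R * t.+2%:R)^-1 :> R.
    by move: t1 tp; rewrite E; move: (t.+1%:R) => x x0 x1; field; rewrite !gt_eqF.
  rewrite -[leLHS]invrK lef_pV2 ?posrE ?invr_gt0 ?mulr_gt0// ?divr_gt0 ?exprn_gt0// invf_div.
  have t2 : 1 <= t.+1%:R :> R by rewrite (ler_nat _ 1).
  by move: t2; rewrite E; move: (t.+1%:R) => x x1; nra.
have sumb n : \sum_(0 <= t < n.+2) b t <= delta * (1 - n.+1%:R^-1).
  elim: n => [|n IH].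
    by rewrite !big_nat_recr//= big_nil /b/= !addr0 invr1 subrr mulr0.
  rewrite big_nat_recr//.
  rewrite (_ : delta * (1 - n.+2%:R^-1) =
    delta * (1 - n.+1%:R^-1) + delta * (n.+1%:R^-1 - n.+2%:R^-1)); last by ring.
  exact: lerD IH (bt n).
move=> n; apply: (@le_trans _ _ (\sum_(0 <= t < n.+2) b t)).
  rewrite (@big_cat_nat _ _ _ n 0 n.+2)//= ?leqW// lerDl sumr_ge0// => t _.
  by rewrite /b; case: ifP => // _; rewrite !mulr_ge0// expR_ge0.
apply: (le_trans (sumb n)).
rewrite -[leRHS]mulr1 ler_pM2l// gerBl invr_ge0//.
Qed.

End false_alarm.

(** * Detection delay *)

Section detection.
Context (R : realType).

(** Supplies a grid point at which each error term of [Astat_lower_tail] is bounded when th = 1/(16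
    z0): threshold, centring on the support, noise variance, and the quadratic term in k. *)
Lemma detection_scale (p k t tau : nat) : (0 < p)%N -> (0 < k <= p)%N ->
  (0 < tau)%N -> (tau < t <= 2 * tau)%N ->
  let z0 : R := zfun k p (2 * tau) in
  exists s, [/\ @in_sgrid R p t s, zfun s p t <= 3 * z0,
    k%:R * (nu (thr p s t) - 1) <= 20 * z0,
    p%:R * qtail (thr p s t) <= 2 * z0 ^+ 2 & k%:R <= 2 * z0 ^+ 2] /\ 1 / 2 <= z0.
Proof.
move=> p0 /andP[k0 kp] tau0 /andP[taut t2tau] z0.
have t2 : (2 <= t)%N by lia. have tt2 : (2 <= 2 * tau)%N by lia.
have L12 := ln_nat_ge R t2.
set L := ln t%:R : R in L12; set L2 := ln (2 * tau)%:R : R.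
have LL2 : L <= L2 by rewrite ler_ln ?posrE ?ltr0n ?ler_nat//; lia.
have pR : 0 < p%:R :> R by rewrite ltr0n.
have p1 : 1 <= p%:R :> R by rewrite (ler_nat _ 1).
have kR : 0 < k%:R :> R by rewrite ltr0n.
have k1 : 1 <= k%:R :> R by rewrite (ler_nat _ 1).
have kpR : k%:R <= p%:R :> R by rewrite ler_nat.
have pL0 : 0 <= p%:R * L by apply: mulr_ge0; lra.
have pL20 : 0 <= p%:R * L2 by apply: mulr_ge0; lra.
have pLL2 : p%:R * L <= p%:R * L2 by rewrite ler_pM2l.
have SS2 : Num.sqrt (p%:R * L) <= Num.sqrt (p%:R * L2) by rewrite ler_wsqrtr.
have sparse0 : k%:R <= Num.sqrt (p%:R * L2) ->
    [/\ 1 <= ln (expR 1 * p%:R * L2 / k%:R ^+ 2),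
     k%:R * ln (expR 1 * p%:R * L2 / k%:R ^+ 2) <= z0 & L2 <= z0].
  move=> kS2; have [kpL _ zE] := thr_sparse p0 k0 tt2 kS2.
  split; first exact: sparse_ln_ge1.
    by rewrite /z0 zE le_max lexx.
  by rewrite /z0 zE le_max lexx orbT.
have [kS|Sk] := leP (k%:R : R) (Num.sqrt (p%:R * L)); last first.
  have Sz0 : Num.sqrt (p%:R * L) <= z0.
    (* k is dense at [t] but may still be sparse at 2 tau; then z0 >= k > sqrt (p log t) all the
       same. *)
    have [kS2|S2k] := leP (k%:R : R) (Num.sqrt (p%:R * L2)); last first.
      by have [_] := thr_dense S2k; rewrite -/L2 /z0 => ->.
    have [l1 kz _] := sparse0 kS2.
    apply: (le_trans (ltW Sk)); apply: le_trans kz.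
    by rewrite ler_peMr// ltW.
  have Sp : Num.sqrt (p%:R * L) < p%:R :> R by exact: lt_le_trans kpR.
  have [a0 zE] := thr_dense Sp.
  have z0p : p%:R * L <= z0 ^+ 2.
    rewrite -[leLHS]sqr_sqrtr// lerXn2r// nnegrE ?sqrtr_ge0//.
    by apply: le_trans Sz0; exact: sqrtr_ge0.
  have pL2 : p%:R * (1 / 2) <= p%:R * L by rewrite ler_pM2l.
  have z00 : 1 / 2 <= z0.
    apply: le_trans Sz0; rewrite -[leLHS]ger0_norm; last by lra.
    by rewrite -sqrtr_sqr ler_wsqrtr//; lra.
  exists p; split => //; split.
  - by left.
  - by rewrite zE -/L; lra.
  - rewrite a0; have := nu0_le1 R => n1.
    apply: (@le_trans _ _ 0); last by lra.
    by apply: mulr_ge0_le0; [exact: ltW|lra].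
  - rewrite a0; have h := qtail_le1 (0 : R).
    apply: (@le_trans _ _ (p%:R * 1)); first by rewrite ler_pM2l.
    by lra.
  - by lra.
have [l1 kz Lz] := sparse0 (le_trans kS SS2).
set l0 := ln _ in l1 kz.
(* The power of 2 with s <= k < 2 s; being at most k, it lies in the grid. *)
pose j := trunc_log 2 k.
have /andP[jk kj] : (2 ^ j <= k < 2 ^ j.+1)%N by apply: trunc_log_bounds.
set s := (2 ^ j)%N in jk.
have s0 : (0 < s)%N by rewrite expn_gt0.
have sk : s%:R <= k%:R :> R by rewrite ler_nat.
have ks : k%:R <= 2 * s%:R :> R by rewrite -natrM ler_nat /s -expnS ltnW.
have sR : 0 < s%:R :> R by rewrite ltr0n.
have sS : s%:R <= Num.sqrt (p%:R * ln t%:R) :> R by exact: le_trans kS.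
have [spL aE zE] := thr_sparse p0 s0 t2 sS.
set l := ln _ in aE zE.
have z00 : 1 / 2 <= z0 by lra.
(* Passing from k to s >= k/2 multiplies the argument of the logarithm by at most 4 <= e^2, and log
   t <= log (2 tau). *)
have ll0 : l <= l0 + 2.
  have x0 : 0 < expR 1 * p%:R * L2 / k%:R ^+ 2.
    by rewrite divr_gt0 ?exprn_gt0// -mulrA mulr_gt0 ?expR_gt0// mulr_gt0//; lra.
  have -> : l0 + 2 = ln (expR 2 * (expR 1 * p%:R * L2 / k%:R ^+ 2)).
    by rewrite lnM ?posrE ?expR_gt0// expRK addrC.
  rewrite ler_ln ?posrE; last 2 first.
  - by rewrite divr_gt0 ?exprn_gt0// -mulrA mulr_gt0 ?expR_gt0// mulr_gt0// -/L; lra.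
  - by rewrite mulr_gt0 ?expR_gt0.
  have e4 : 4 <= expR 2 :> R.
    have -> : (2 : R) = 1 + 1 by lra.
    by rewrite expRD; have := expR1_ge2 R; move: (expR 1) => e he; nra.
  apply: (@le_trans _ _ (4 * (expR 1 * p%:R * L2 / k%:R ^+ 2))); last first.
    by apply: ler_wpM2r => //; exact: ltW.
  rewrite ler_pdivrMr ?exprn_gt0// -/L.
  have epL : expR 1 * p%:R * L <= expR 1 * p%:R * L2.
    by rewrite -!mulrA ler_pM2l ?expR_gt0.
  have epL20 : 0 <= expR 1 * p%:R * L2 by rewrite -mulrA mulr_ge0 ?expR_ge0.
  apply: (le_trans epL).
  have -> : 4 * (expR 1 * p%:R * L2 / k%:R ^+ 2) * s%:R ^+ 2 =
      expR 1 * p%:R * L2 * ((2 * s%:R) ^+ 2 / k%:R ^+ 2).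
    by field; rewrite gt_eqF.
  apply: ler_peMr => //; rewrite ler_pdivlMr ?exprn_gt0// mul1r.
  by rewrite lerXn2r// nnegrE// ?ltW// mulr_ge0// ltW.
have kl0 : k%:R <= k%:R * l0 by rewrite ler_peMr// ltW.
exists s; split => //; split.
- apply/in_sgridP => //; right; exists j; split => //.
  exact: leq_trans kp.
- have h1 : s%:R * l <= 3 * z0.
    apply: (@le_trans _ _ (s%:R * (l0 + 2))); first by rewrite ler_pM2l.
    apply: (@le_trans _ _ (k%:R * (l0 + 2))).
      by apply: ler_wpM2r => //; clear -l1; lra.
    by clear -kl0 kz; lra.
  have h2 : L <= 3 * z0 by clear -LL2 Lz z00; lra.
  by rewrite zE ge_max h1 h2.
(* nu - 1 <= 4 l + 7 <= 4 l0 + 15, and both k l0 and k are at most z0. *)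
- have := nu_le (thr_ge0 R p t s); rewrite aE => hn.
  apply: (@le_trans _ _ (k%:R * (4 * l0 + 15))).
    by rewrite ler_pM2l//; lra.
  by lra.
- have L0 : 0 < ln t%:R :> R by rewrite -/L; lra.
  apply: (le_trans (sparse_pq pR sR L0 (qtail_sparse p0 s0 t2 sS))).
  rewrite -/L ler_pdivrMr//.
  have h1 : s%:R ^+ 2 <= z0 ^+ 2.
    by apply: lerXn2r; rewrite ?nnegrE; lra.
  have h2 : z0 ^+ 2 * (1 / 2) <= z0 ^+ 2 * L by rewrite ler_wpM2l// sqr_ge0.
  by lra.
- have : z0 * (1 / 2) <= z0 * z0 by rewrite ler_wpM2l//; lra.
  by rewrite expr2; lra.
Qed.

Context (p : nat) (mu1 mu2 : 'I_p -> R) (sigma : R).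
Hypothesis sigma0 : 0 < sigma.

Lemma l2dist_sqr : l2dist mu1 mu2 ^+ 2 = \sum_(j < p) (mu2 j - mu1 j) ^+ 2.
Proof. by rewrite sqr_sqrtr// sumr_ge0// => j _; exact: sqr_ge0. Qed.

(** [sparsity] counts a classical set; [Astat_lower_tail] takes a finite one. *)
Lemma sparsityE : sparsity mu1 mu2 = #|[set j | mu2 j != mu1 j]%SET|.
Proof.
apply: eq_card => j; apply/idP/idP => [/set_mem h|h].
  by rewrite finset.inE; exact: h.
by apply: mem_set; move: h; rewrite finset.inE.
Qed.

Lemma sparsity_gt0 : 0 < l2dist mu1 mu2 ^+ 2 -> (0 < sparsity mu1 mu2 <= p)%N.
Proof.
rewrite sparsityE => h; apply/andP; split; last first.
  by rewrite (leq_trans (max_card _))// card_ord.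
rewrite lt0n; apply: contraTN h => /eqP/card0_eq E.
rewrite l2dist_sqr big1 ?ltxx// => j _.
have /negbFE/eqP -> : (mu2 j != mu1 j) = false by have := E j; rewrite finset.inE.
by rewrite subrr expr0n.
Qed.

Lemma cusum_mean_change (tau t g : nat) j : (0 < g)%N -> (tau <= t - g)%N -> (g < t)%N ->
  cusum_mean sigma mu1 mu2 (Some tau) t g j =
  Num.sqrt (g%:R / (t%:R * (t - g)%:R)) * tau%:R * (mu1 j - mu2 j) / sigma.
Proof.
move=> g0 taun gt; rewrite /cusum_mean -mulr_suml; congr (_ / _).
rewrite (cusum_coef_sum t g (fun i => mean_at mu1 mu2 (Some tau) i j)).
set n := (t - g)%N in taun *.
have s1 : \sum_(1 <= i < n.+1) mean_at mu1 mu2 (Some tau) i j =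
    tau%:R * mu1 j + (n%:R - tau%:R) * mu2 j.
  rewrite (@big_cat_nat _ _ _ tau.+1)//=.
  rewrite (eq_big_nat _ _ (F2 := fun=> mu1 j)); last first.
    by move=> i /andP[_]; rewrite ltnS => ->.
  rewrite [X in _ + X](eq_big_nat _ _ (F2 := fun=> mu2 j)); last first.
    by move=> i /andP[ti _]; rewrite leqNgt ti.
  rewrite !sumr_const_nat !subSS subn0 -natrB//.
  by rewrite (mulrC tau%:R) (mulrC (n - tau)%:R) !mulr_natr.
have s2 : \sum_(n.+1 <= i < t.+1) mean_at mu1 mu2 (Some tau) i j = g%:R * mu2 j.
  rewrite (eq_big_nat _ _ (F2 := fun=> mu2 j)); last first.
    move=> i /andP[ni _] /=; rewrite leqNgt (leq_ltn_trans taun)//.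
  by rewrite sumr_const_nat subSS subKn ?(ltnW gt)// mulrC mulr_natr.
rewrite s1 s2.
have n0 : 0 < n%:R :> R by rewrite ltr0n subn_gt0.
have gR : 0 < g%:R :> R by rewrite ltr0n.
have tR : 0 < t%:R :> R by rewrite ltr0n (leq_trans _ gt).
have E (x y : R) : 0 <= y -> Num.sqrt x * y = Num.sqrt (y ^+ 2 * x).
  by move=> y0; rewrite sqrtrM ?sqr_ge0// sqrtr_sqr ger0_norm// mulrC.
(* By this balance of the weights the terms in [mu2] combine to - tau times [mu2 j], leaving a
   multiple of the jump. *)
have sE : Num.sqrt (n%:R / (t%:R * g%:R)) * g%:R =
    Num.sqrt (g%:R / (t%:R * n%:R)) * n%:R :> R.
  by rewrite !E ?ler0n//; congr Num.sqrt; field; rewrite !gt_eqF.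
by rewrite [X in _ - X]mulrA sE; ring.
Qed.

(** 12 = 3 times 4: the grid gives g >= D/3, and t and t - g are at most 2 tau, so tau^2 / (t (t-g))
    >= 1/4. *)
Lemma cusum_energy (tau D t g : nat) : t = (tau + D)%N -> (0 < g <= D)%N ->
  (D <= tau)%N -> (D <= 3 * g)%N ->
  D%:R * l2dist mu1 mu2 ^+ 2 / (12 * sigma ^+ 2) <=
  \sum_(j < p) cusum_mean sigma mu1 mu2 (Some tau) t g j ^+ 2.
Proof.
move=> tE /andP[g0 gD] Dtau D3g.
have gt : (g < t)%N by lia. have taun : (tau <= t - g)%N by lia.
set n := (t - g)%N in taun.
have n0 : 0 < n%:R :> R by rewrite ltr0n subn_gt0.
have gR : 0 < g%:R :> R by rewrite ltr0n.
have tR : 0 < t%:R :> R by rewrite ltr0n (leq_trans _ gt).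
have tauR : 0 < tau%:R :> R by rewrite ltr0n; lia.
have -> : \sum_(j < p) cusum_mean sigma mu1 mu2 (Some tau) t g j ^+ 2 =
    g%:R / (t%:R * n%:R) * tau%:R ^+ 2 / sigma ^+ 2 * l2dist mu1 mu2 ^+ 2.
  rewrite l2dist_sqr mulr_sumr; apply: eq_bigr => j _.
  rewrite cusum_mean_change// expr_div_n !exprMn sqr_sqrtr; last first.
    by rewrite divr_ge0 ?ler0n// mulr_ge0 ?ler0n.
  have -> : (mu1 j - mu2 j) ^+ 2 = (mu2 j - mu1 j) ^+ 2 by rewrite -sqrrN opprB.
  by rewrite [LHS]mulrAC.
set f := _ ^+ 2; have f0 : 0 <= f by exact: sqr_ge0.
have -> : g%:R / (t%:R * n%:R) * tau%:R ^+ 2 / sigma ^+ 2 * f =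
    g%:R / (t%:R * n%:R) * tau%:R ^+ 2 * (f / sigma ^+ 2).
  by rewrite -mulrA [_^-1 * f]mulrC.
have -> : D%:R * f / (12 * sigma ^+ 2) = D%:R / 12 * (f / sigma ^+ 2).
  by field; rewrite gt_eqF.
apply: ler_wpM2r; first by rewrite divr_ge0// sqr_ge0.
have D3 : D%:R <= 3 * g%:R :> R by rewrite -natrM ler_nat.
have tn : t%:R * n%:R <= 4 * tau%:R ^+ 2 :> R.
  have h1 : t%:R <= 2 * tau%:R :> R by rewrite -natrM ler_nat; lia.
  have h2 : n%:R <= 2 * tau%:R :> R by rewrite -natrM ler_nat /n; lia.
  have -> : 4 * tau%:R ^+ 2 = (2 * tau%:R) * (2 * tau%:R) :> R by ring.
  by apply: ler_pM => //; exact: ltW.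
have tn0 : 0 < t%:R * n%:R :> R by rewrite mulr_gt0.
apply: (@le_trans _ _ (g%:R / 4)); first by lra.
rewrite -mulrA; apply: ler_wpM2l; first exact: ltW.
by rewrite mulrC ler_pdivlMr//; lra.
Qed.

Context d (T : measurableType d) (P : probability T R).
Context (Y : nat -> 'I_p -> T -> R) (tau : nat) (lam delta : R).
Hypotheses (p0 : (0 < p)%N) (tau0 : (0 < tau)%N) (lam0 : 0 < lam) (delta0 : 0 < delta).
Hypothesis model : gauss_model P Y sigma mu1 mu2 (Some tau).

Let z0 : R := zfun (sparsity mu1 mu2) p (2 * tau).
(** 384 = 16 times 2 times 12, from th z0 = 1/16, the halved noncentrality in [lower_mgf] and
    [cusum_energy]. In the bracket, lam pays for the threshold, 11 for the noise terms 9 + 3/2, and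
    delta^-1 is left over for the probability. *)
Let C2 : R := 384 * (lam + 11 + delta^-1).

Lemma detection_bound (D : nat) : (0 < D <= tau)%N -> 0 < l2dist mu1 mu2 ^+ 2 ->
  C2 * sigma ^+ 2 / l2dist mu1 mu2 ^+ 2 * z0 <= D%:R ->
  ((1 - delta)%:E <=
   P [set w | (tau_hat Y sigma lam w <= ((tau + D)%:R : R)%:E)%E])%E.
Proof.
move=> /andP[D0 Dtau] phi0 DC; pose t := (tau + D)%N.
have t2 : (2 <= t)%N by rewrite /t; lia.
have [|g [gG [gD D3g]]] := @ggrid_scale R t D D0; first by rewrite /t; lia.
have gt : (0 < g < t)%N by exact: in_ggrid_range gG.
have /andP[g0 gt'] := gt.
have taun : (tau <= t - g)%N by clear -gD; rewrite /t; lia.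
have tt : (tau < t <= 2 * tau)%N by rewrite /t; lia.
have [s [[sS zs nus pq kz] z00]] := detection_scale p0 (sparsity_gt0 phi0) tau0 tt.
rewrite -/z0 in zs nus pq kz z00.
have zp : 0 < lam * zfun s p t by rewrite mulr_gt0// zfun_gt0.
pose B := [set w | Astat Y sigma t s g w <= lam * zfun s p t].
have hitE : hit Y sigma lam t s g = ~` B.
  apply/seteqP; split => w; rewrite /hit /B/= ltr_pdivlMr// mul1r ltNge.
    by move/negP.
  by move/negP.
have mh := measurable_hit lam sigma0 model t s g.
have mB : measurable B by rewrite -[B]setCK -hitE; exact: measurableC.
have PB : (P B <= delta%:E)%E.
  have z0p : 0 < z0 by lra.
  pose th := (16 * z0)^-1.
  have th8 : 0 <= th <= 1 / 8.
    rewrite invr_ge0 mulr_ge0 ?(ltW z0p)//=.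
    by rewrite div1r lef_pV2 ?posrE ?mulr_gt0//; lra.
  have m0 j : j \notin [set j | mu2 j != mu1 j]%SET ->
      cusum_mean sigma mu1 mu2 (Some tau) t g j = 0.
    rewrite finset.inE negbK => /eqP mm; rewrite (cusum_mean_change _ g0 taun gt').
    by rewrite mm subrr mulr0 mul0r.
  apply: (le_trans (Astat_lower_tail sigma0 model g0 gt' s (lam * zfun s p t) m0 th8)).
  rewrite lee_fin; apply: le_trans (expR_Ninv_le delta0); rewrite ler_expR.
  rewrite -sparsityE.
  have tz : th * z0 = 1 / 16 by rewrite /th; field; rewrite gt_eqF.
  have /andP[t0 _] := th8; clearbody th.
  have e1 : th * (lam * zfun s p t) <= 3 / 16 * lam.
    have -> : 3 / 16 * lam = lam * th * (3 * z0).
      transitivity (3 * lam * (th * z0)); last by ring.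
      by rewrite tz; field.
    have -> : th * (lam * zfun s p t) = lam * th * zfun s p t by ring.
    by apply: ler_wpM2l; [rewrite mulr_ge0// ltW|exact: zs].
  have e2 : 1152 * th ^+ 2 * qtail (thr p s t) * p%:R <= 9.
    (* This is where 9 comes from: 1152 times 2/16^2. *)
    have tz2 : th ^+ 2 * (2 * z0 ^+ 2) = 1 / 128.
      transitivity (2 * (th * z0) ^+ 2); first by ring.
      by rewrite tz; field.
    have -> : (9 : R) = 1152 * (th ^+ 2 * (2 * z0 ^+ 2)) by rewrite tz2; lra.
    have -> : 1152 * th ^+ 2 * qtail (thr p s t) * p%:R =
      1152 * (th ^+ 2 * (p%:R * qtail (thr p s t))) by ring.
    apply: ler_wpM2l; first exact: ler0n.
    by apply: ler_wpM2l => //; exact: sqr_ge0.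
  have e3 : (th * (nu (thr p s t) - 1) + 2 * th ^+ 2) * (sparsity mu1 mu2)%:R <= 3 / 2.
    have h1 : th * ((sparsity mu1 mu2)%:R * (nu (thr p s t) - 1)) <= th * (20 * z0).
      exact: ler_wpM2l.
    have h2 : th ^+ 2 * (sparsity mu1 mu2)%:R <= th ^+ 2 * (2 * z0 ^+ 2).
      by apply: ler_wpM2l => //; exact: sqr_ge0.
    have h3 : th * (20 * z0) = 20 / 16.
      transitivity (20 * (th * z0)); first by ring.
      by rewrite tz; field.
    have h4 : th ^+ 2 * (2 * z0 ^+ 2) = 2 / 256.
      transitivity (2 * (th * z0) ^+ 2); first by ring.
      by rewrite tz; field.
    rewrite mulrDl; move: h1 h2; rewrite h3 h4.
    rewrite (_ : th * ((sparsity mu1 mu2)%:R * (nu (thr p s t) - 1)) =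
       th * (nu (thr p s t) - 1) * (sparsity mu1 mu2)%:R); last by ring.
    rewrite -[2 * th ^+ 2 * _]mulrA.
    move: (th * (nu _ - 1) * _) (th ^+ 2 * _) => u v; lra.
  have e4 : C2 / 384 <= th / 2 * \sum_(j < p)
      cusum_mean sigma mu1 mu2 (Some tau) t g j ^+ 2.
    have En := @cusum_energy tau D t g erefl gD Dtau D3g.
    have s20 : 0 < sigma ^+ 2 by rewrite exprn_gt0.
    have h : C2 * z0 / 12 <= D%:R * l2dist mu1 mu2 ^+ 2 / (12 * sigma ^+ 2).
      have -> : C2 * z0 / 12 = C2 * sigma ^+ 2 / l2dist mu1 mu2 ^+ 2 * z0 *
          (l2dist mu1 mu2 ^+ 2 / (12 * sigma ^+ 2)).
        have E (c z u v : R) : 0 < u -> 0 < v -> c * z / 12 = c * v / u * z * (u / (12 * v)).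
          by move=> u0 v0; field; rewrite !gt_eqF.
        exact: E.
      rewrite -[leRHS]mulrA; apply: ler_wpM2r => //.
      apply: divr_ge0; first exact: sqr_ge0.
      by apply: mulr_ge0; [exact: ler0n|exact: sqr_ge0].
    have -> : C2 / 384 = th / 2 * (C2 * z0 / 12).
      transitivity (C2 / 24 * (th * z0)); last by field.
      by rewrite tz; field.
    apply: ler_wpM2l; first by rewrite divr_ge0.
    exact: le_trans En.
  have C2E : C2 / 384 = lam + 11 + delta^-1 by rewrite /C2; field; rewrite gt_eqF.
  move: e1 e2 e3 e4; rewrite C2E.
  move: (th * (lam * _)) (1152 * _ * _ * _) (_ * (sparsity _ _)%:R) (th / 2 * _).
  by move=> a b c e; move: lam0; lra.
apply: (@le_trans _ _ (P (hit Y sigma lam t s g))).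
  rewrite hitE probability_setC// EFinB leeB//.
apply: le_measure; rewrite ?inE//; first exact: measurable_tau_hat_le model _.
move=> w h; apply: (@tau_hat_le_alarm _ _ _ _ _ _ _ t (tau + D)%N) => //.
by split => //; exists g; split => //; exists s; split.
Qed.

End detection.

Unset Implicit Arguments. Set Strict Implicit. Set Printing Implicit Defensive.

Theorem theorem2 (R : realType) (delta : R) :
  0 < delta < 1 ->
  exists C1 : R, 0 < C1 /\
  forall lam : R, 0 < lam ->
  exists C2 : R, 0 < C2 /\
  ((C1 <= lam ->
     forall (d : measure_display) (T : measurableType d) (P : probability T R)
       (p : nat) (sigma : R) (mu1 mu2 : 'I_p -> R) (Y : nat -> 'I_p -> T -> R),
       (0 < p)%N -> 0 < sigma ->
       gauss_model P Y sigma mu1 mu2 None ->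
       (P [set w | tau_hat Y sigma lam w < +oo] <= delta%:E)%E)
   /\
   (forall (d : measure_display) (T : measurableType d) (P : probability T R)
       (p : nat) (sigma : R) (mu1 mu2 : 'I_p -> R) (Y : nat -> 'I_p -> T -> R)
       (tau : nat),
       (0 < p)%N -> 0 < sigma -> (1 <= tau)%N ->
       gauss_model P Y sigma mu1 mu2 (Some tau) ->
       C2 * zfun (sparsity mu1 mu2) p (2 * tau) <=
         tau%:R * (l2dist mu1 mu2) ^+ 2 / sigma ^+ 2 ->
       ((1 - delta)%:E <=
         P [set w | (tau_hat Y sigma lam w - (tau%:R)%:E <=
            ((Num.ceil (C2 * sigma ^+ 2 / (l2dist mu1 mu2) ^+ 2
                        * zfun (sparsity mu1 mu2) p (2 * tau)))%:~R)%:E)%E])%E)).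
Proof.
move=> /andP[d0 d1]; have dlt : 0 < delta < 1 by rewrite d0 d1.
have dV : 0 < delta^-1 by rewrite invr_gt0.
(* 288 keeps the variance below half of the linear Chernoff term; the rest makes the bounds over all
   times sum to at most delta. *)
exists (288 + 32 * (4 + 2 / delta)); split.
  by apply: addr_gt0; lra.
move=> lam lam0; exists (384 * (lam + 11 + delta^-1)); split.
  by apply: mulr_gt0; lra.
split.
  move=> lamC d T P p sigma mu1 mu2 Y p0 sigma0 model.
  apply: (false_alarm_bound p0 sigma0 _ model dlt); move: lamC; lra.
move=> d T P p sigma mu1 mu2 Y tau p0 sigma0 tau1 model.
set z0 := zfun _ _ _; set C2 := 384 * _; set f := l2dist _ _ ^+ 2 => hyp.
have z0p : 0 < z0 by apply: zfun_gt0 => //; lia.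
have C20 : 0 < C2 by apply: mulr_gt0; lra.
have s20 : 0 < sigma ^+ 2 by rewrite exprn_gt0.
have tauR : 0 < tau%:R :> R by rewrite ltr0n.
(* A zero jump would make the signal condition read C2 z0 <= 0, so the later divisions by [f] are
   genuine. *)
have f0 : 0 < f.
  rewrite lt0r sqr_ge0 andbT; apply/eqP => fE.
  have : 0 < C2 * z0 by rewrite mulr_gt0.
  by move: hyp; rewrite fE mulr0 mul0r => /le_lt_trans h /h; rewrite ltxx.
set x := C2 * sigma ^+ 2 / f * z0.
have x0 : 0 < x.
  by apply: mulr_gt0 => //; apply: divr_gt0 => //; exact: mulr_gt0.
(* The signal condition, rearranged, says that the delay before rounding is at most tau; tau being
   an integer, rounding up preserves this. *)
have xtau : x <= tau%:R.
  have -> : x = C2 * z0 * (sigma ^+ 2 / f) by rewrite /x; ring.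
  rewrite -ler_pdivlMr ?divr_gt0// invf_div mulrA; exact: hyp.
have c0 : (0 < Num.ceil x)%R by rewrite ceil_gt0.
have [D DE] : exists D : nat, Num.ceil x = D%:Z.
  by exists `|Num.ceil x|%N; rewrite gez0_abs// ltW.
have xD : x <= D%:R by have := ceil_ge x; rewrite DE.
have Dtau : (0 < D <= tau)%N.
  apply/andP; split; first by move: c0; rewrite DE.
  have : (Num.ceil x <= tau%:Z)%R by rewrite ceil_le_int.
  by rewrite DE.
rewrite DE.
have E w : (tau_hat Y sigma lam w - tau%:R%:E <= (D%:Z%:~R)%:E)%E =
    (tau_hat Y sigma lam w <= ((tau + D)%:R : R)%:E)%E.
  by rewrite leeBlDr// -EFinD natrD addrC.
under eq_set do rewrite E.
exact: (detection_bound sigma0 p0 tau1 lam0 d0 model Dtau f0 xD).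
Qed.
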